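(* Let $\gamma\in(0,1]$, $\beta=\gamma^{-1}-1$, $c=(\log2)^{\beta}$, and let $T\colon[0,1]\to[0,1]$ be defined by $$T(x)=\begin{cases}x\Bigl(1+\dfrac{c}{|\log x|^{\beta}}\Bigr),&x\le1/2,\\[2mm]2x-1,&x>1/2.\end{cases}$$ Let $\nu$ be the unique $T$-invariant probability measure absolutely continuous with respect to Lebesgue measure on $[0,1]$. For any measurable ($\nu$-integrable) function $f\colon[0,1]\to\mathbb{R}$, let $S_n(f)=\sum_{k=0}^{n-1}f\circ T^k-n\,\nu(f)$, where $\nu(f)=\int f\,d\nu$. a) There exist a Lipschitz function $f$ with $\nu(f)>0$ and positive constants $c_1,c_2,\kappa_1,\kappa_2$ such that, for all $n>2/\nu(f)$, $$c_1e^{-\kappa_1n^{\gamma}}\le\nu\bigl(|S_n(f)|>n\,\nu(f)/2\bigr)\le c_2e^{-\kappa_2n^{\gamma}}.$$ b) There exist an unbounded measurable function $f$ satisfying, for all $t>0$, $A_1e^{-B_1t^{1/\delta}}\le\nu(|f|>t)\le A_2e^{-B_2t^{1/\delta}}$ for some $A_1,A_2,B_1,B_2>0$ and $\delta>0$, and positive constants $c_1,c_2,\kappa_1,\kappa_2$ such that, for all $n\ge1$, $$c_1e^{-\kappa_1n^{\gamma/(1+\gamma\delta)}}\le\nu\bigl(|S_n(f)|>n\bigr)\le c_2e^{-\kappa_2n^{\gamma/(1+\gamma\delta)}}.$$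
   Context: Convention: $T(0)=0$. The constant $c$ is chosen so that $T(1/2)=1$. It is known that $T$ admits a unique invariant probability measure $\nu$ absolutely continuous with respect to Lebesgue measure. *)

(* Defs.v *)
From mathcomp Require Export all_boot all_order all_algebra.
From mathcomp Require Export all_classical all_reals all_analysis.
Export Order.TTheory GRing.Theory Num.Theory.
Export numFieldNormedType.Exports.

Set Implicit Arguments.
Unset Strict Implicit.
Unset Printing Implicit Defensive.

Local Open Scope classical_set_scope.
Local Open Scope ring_scope.

(* [0, 1] is a subset of R, not a type: maps on [0, 1] are functions R -> R of
   which only the restriction to [0, 1] matters, and measures on [0, 1] are
   Borel measures on R carried by [0, 1]. *)
Definition unitI {R : realType} : set R := `[0, 1]%classic.

Definition beta {R : realType} (gamma : R) : R := gamma^-1 - 1.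

Definition cT {R : realType} (gamma : R) : R := (ln 2) `^ (beta gamma).

Definition Tmap {R : realType} (gamma x : R) : R :=
  if x == 0 then 0
  else if x <= 2^-1 then x * (1 + cT gamma / (`|ln x| `^ (beta gamma)))
  else 2 * x - 1.

(* Invariance is tested on Borel subsets A of [0, 1]; the preimage of A is
   taken inside [0, 1], where alone the formula for Tmap is meaningful. *)
Definition invariant_acpm {R : realType} (gamma : R)
    (nu : probability (measurableTypeR R) R) : Prop :=
  [/\ nu (unitI : set (measurableTypeR R)) = 1%E,
      nu `<< lebesgue_measure
    & forall A : set (measurableTypeR R), measurable A -> A `<=` unitI ->
        nu (unitI `&` Tmap gamma @^-1` A) = nu A].

(* nu(f); meaningful for f integrable on [0, 1]. *)
Definition mean {R : realType} (nu : probability (measurableTypeR R) R)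
    (f : R -> R) : R :=
  \int[nu]_(x in unitI) f x.

Definition birkhoff_dev {R : realType} (gamma : R)
    (nu : probability (measurableTypeR R) R) (f : R -> R) (n : nat) (x : R) : R :=
  \sum_(0 <= k < n) f (iter k (Tmap gamma) x) - n%:R * mean nu f.

Definition abs_gt {R : realType} (g : R -> R) (t : R) :
    set (measurableTypeR R) :=
  [set x | unitI x /\ t < `|g x|].

(* Main.v *)
(** Both inverse branches of [T] are increasing and concave, so the transfer
    operator preserves decreasing densities. Approximating the density of [nu]
    in [L^1] by functions that are almost constant on long cylinders shows that
    [nu] has a concave distribution function [F]. Hence [F z >= z], and
    [F z - F (psi0 z) <= z] for the left inverse branch [psi0], which makes
    [F z] at most of order [sqrt z].

    In the coordinate [|ln x|^(1/gamma)] the left branch moves points by an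
    amount bounded above and below, so the excursion near [0] that starts at
    [x] has length of that order. A function growing like the [q]-th power of
    this coordinate accumulates [m^(q+1)] over an excursion of length [m], and
    an excursion that long has probability about [exp (- c m^gamma)]: this
    gives the lower bounds, with [q = 0] in (a), [q = 1] and [delta = 1 / gamma]
    in (b).

    For the upper bounds all of this contribution is charged to the step at
    which the orbit jumps back from [(1/2, 1]]. Weighting the jump into [y] by a
    decreasing function [e^(v y)] preserves concavity of distribution
    functions, and concavity bounds the mass near [1/2], so one step multiplies
    the total mass by at most [1 + int (e^v - 1)]. Discarding the orbits that go
    too deep, Markov's inequality concludes. *)
Require Import Defs.
From mathcomp Require Import measurable_realfun ring lra.
Set Implicit Arguments.
Unset Strict Implicit.
Unset Printing Implicit Defensive.

Local Open Scope classical_set_scope.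
Local Open Scope ring_scope.

(** * Elementary inequalities for logarithms, exponentials and real powers *)

Section elementary_inequalities.
Context {R : realType}.
Implicit Types x y b : R.

Lemma ln_le_subr1 x : 0 < x -> ln x <= x - 1.
Proof.
by move=> x0; rewrite -{1}(subrK 1 x) addrC; apply: le_ln1Dx; lra.
Qed.

Lemma half_le_ln1D x : 0 <= x <= 1 -> x / 2 <= ln (1 + x).
Proof.
move=> /andP[x0 x1]; have p0 : 0 < 1 + x by lra.
have := @ln_le_subr1 (1 + x)^-1; rewrite invr_gt0 => /(_ p0).
rewrite lnV ?posrE// => h; suff : x / 2 <= 1 - (1 + x)^-1 by lra.
have -> : 1 - (1 + x)^-1 = x / (1 + x) by field; rewrite gt_eqF.
by rewrite ler_wpM2l// lef_pV2 ?posrE//; lra.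
Qed.

(** Write the power as [e^u] with [u = - b ln x] and use [1 + u <= e^u] and [ln x <= x - 1]. *)
Lemma powRN_tangent x b : 0 < x -> 0 <= b -> 1 - b * (x - 1) <= x `^ (- b).
Proof.
move=> x0 b0; rewrite /powR gt_eqF//; apply: le_trans (expR_ge1Dx _).
by rewrite mulNr lerD2l lerN2 ler_wpM2l// ln_le_subr1.
Qed.

(** Bernoulli's inequality: for [x > 0], the previous tangent at [x^-1], multiplied by [x]. *)
Lemma powR_tangent x b : 0 <= x -> 0 <= b ->
  1 - (1 + b) * (1 - x) <= x `^ (1 + b).
Proof.
rewrite le_eqVlt => /predU1P[<-|x0] b0; first by apply: le_trans (powR_ge0 _ _); lra.
have xi0 : 0 < x^-1 by rewrite invr_gt0.
have e : x^-1 `^ (- b) = x `^ b.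
  by rewrite -(powR_inv1 (ltW x0)) -powRrM mulN1r opprK.
have := powRN_tangent xi0 b0; rewrite e.
move=> /(ler_wpM2l (ltW x0)); rewrite powRD; last by rewrite (gt_eqF x0) implybT.
rewrite (powRr1 (ltW x0)) => h; apply: le_trans h.
suff -> : x * (1 - b * (x^-1 - 1)) = 1 - (1 + b) * (1 - x) by [].
by field; rewrite gt_eqF.
Qed.

(** The inequality [u <= e^u] at [u = b x / a], raised to the power [a]. It serves to absorb
    polynomial factors into exponentials. *)
Lemma powR_le_expR x a b : 0 <= x -> 0 < a -> 0 < b ->
  x `^ a <= (a / b) `^ a * expR (b * x).
Proof.
move=> x0 a0 b0.
have -> : expR (b * x) = expR (b / a * x) `^ a.
  by rewrite -expRM; congr expR; field; rewrite gt_eqF.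
rewrite -powRM ?expR_ge0//; last by rewrite divr_ge0// ltW.
have d0 : 0 <= a / b * expR (b / a * x) by rewrite mulr_ge0 ?expR_ge0// divr_ge0// ltW.
apply: ge0_ler_powR; rewrite ?nnegrE ?(ltW a0)//.
rewrite -(ler_pM2l (_ : 0 < b / a)) ?divr_gt0// mulrA.
have -> : b / a * (a / b) = 1 by field; rewrite !gt_eqF.
by rewrite mul1r; have := @expR_ge1Dx R (b / a * x); lra.
Qed.

End elementary_inequalities.

(** * The map [T]: convexity of the left branch and displacement of the depth *)

Section dynamics.
Context {R : realType} (gamma : R) (hgamma : 0 < gamma <= 1).
Implicit Types x y z : R.

Local Notation T := (Tmap gamma).
Local Notation b := (beta gamma).

Lemma gamma_gt0 : 0 < gamma. Proof. by case/andP: hgamma. Qed.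

Lemma beta_ge0 : 0 <= b.
Proof. by case/andP: hgamma => g0 g1; rewrite subr_ge0 invf_ge1. Qed.

Lemma ln2_gt0 : 0 < ln 2 :> R. Proof. by apply: ln_gt0; lra. Qed.

Lemma cT_gt0 : 0 < cT gamma. Proof. exact/powR_gt0/ln2_gt0. Qed.

Lemma abs_ln x : 0 < x <= 1 -> `|ln x| = - ln x.
Proof. by case/andP=> x0 x1; rewrite ler0_norm// ln_le0. Qed.

Lemma ln_half : ln 2^-1 = - ln 2 :> R.
Proof. by rewrite lnV// posrE. Qed.

Lemma ln2_le_abs_ln x : 0 < x <= 2^-1 -> ln 2 <= `|ln x|.
Proof.
move=> /andP[x0 x1]; rewrite abs_ln; last by lra.
by rewrite lerNr -ln_half ler_ln ?posrE//; lra.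
Qed.

Definition incr x := cT gamma / (`|ln x| `^ b).

Lemma incr_gt0 x : 0 < x <= 2^-1 -> 0 < incr x.
Proof.
move=> hx; rewrite divr_gt0 ?cT_gt0// powR_gt0//.
exact: lt_le_trans ln2_gt0 (ln2_le_abs_ln hx).
Qed.

Lemma incr_half : incr 2^-1 = 1.
Proof.
rewrite /incr abs_ln; last by lra.
by rewrite ln_half opprK divff// gt_eqF// cT_gt0.
Qed.

Lemma le_incr x y : 0 < x -> x <= y -> y <= 2^-1 -> incr x <= incr y.
Proof.
move=> x0 xy y2; have hy : 0 < y <= 2^-1 by lra.
have ly := lt_le_trans ln2_gt0 (ln2_le_abs_ln hy).
have lxy : `|ln y| <= `|ln x|.
  by rewrite !abs_ln ?lerN2 ?ler_ln ?posrE//; lra.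
rewrite (ler_wpM2l (ltW cT_gt0))// lef_pV2 ?posrE ?powR_gt0//; last exact: lt_le_trans lxy.
by rewrite ge0_ler_powR ?beta_ge0 ?nnegrE.
Qed.

Lemma incr_le1 x : 0 < x <= 2^-1 -> incr x <= 1.
Proof. by case/andP=> x0 x1; rewrite -incr_half le_incr. Qed.

Lemma incr_pow x : 0 < x <= 2^-1 -> `|ln x| `^ b * incr x = cT gamma.
Proof.
move=> hx; rewrite /incr mulrC divfK// gt_eqF// powR_gt0//.
exact: lt_le_trans ln2_gt0 (ln2_le_abs_ln hx).
Qed.

Lemma Tmap0 : T 0 = 0. Proof. by rewrite /Tmap eqxx. Qed.

Lemma Tmap_left x : x <= 2^-1 -> T x = x * (1 + incr x).
Proof. by rewrite /Tmap => ->; case: eqP => // ->; rewrite mul0r. Qed.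

Lemma Tmap_right x : 2^-1 < x -> T x = 2 * x - 1.
Proof. by move=> hx; rewrite /Tmap gt_eqF ?leNgt ?hx//; lra. Qed.

Lemma Tmap_half : T 2^-1 = 1.
Proof. by rewrite Tmap_left// incr_half; lra. Qed.

Lemma Tmap_left_bounds x : 0 <= x <= 2^-1 -> x <= T x <= 2 * x.
Proof.
rewrite le_eqVlt => /andP[/predU1P[<- _|x0 x2]]; first by rewrite Tmap0; lra.
rewrite Tmap_left//; have := @incr_gt0 x; have := @incr_le1 x; rewrite x0 x2.
by move=> /(_ isT) h1 /(_ isT) h2; rewrite mulrDr mulr1; apply/andP; split; nra.
Qed.

Lemma Tmap_left_lt x y : 0 <= x -> x < y -> y <= 2^-1 -> T x < T y.
Proof.
move=> x0 xy y2; have y0 : 0 < y by lra.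
have hy : 0 < y <= 2^-1 by rewrite y0.
move: x0; rewrite le_eqVlt => /predU1P[<-|x0].
  by rewrite Tmap0 (lt_le_trans y0)//; have /andP[] : y <= T y <= 2 * y by apply: Tmap_left_bounds; lra.
rewrite !Tmap_left//; last by lra.
have := le_incr x0 (ltW xy) y2; have := incr_gt0 hy.
have : 0 < incr x by apply: incr_gt0; lra.
by move=> ? ? ?; nra.
Qed.

Lemma Tmap_in_pos x : 0 < x <= 1 -> 0 < T x <= 1.
Proof.
move=> /andP[x0 x1]; case: (leP x 2^-1) => hx.
  have := @Tmap_left_bounds x; rewrite (ltW x0) hx => /(_ isT) /andP[h1 _].
  rewrite (lt_le_trans x0 h1) /=; move: hx; rewrite le_eqVlt => /predU1P[->|hx].
    by rewrite Tmap_half.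
  by rewrite -Tmap_half ltW// Tmap_left_lt// ltW.
by rewrite Tmap_right//; lra.
Qed.

Lemma Tmap_in x : 0 <= x <= 1 -> 0 <= T x <= 1.
Proof.
rewrite le_eqVlt => /andP[/predU1P[<- _|x0 x1]]; first by rewrite Tmap0; lra.
have /andP[y0 ->] : 0 < T x <= 1 by apply: Tmap_in_pos; rewrite x0.
by rewrite ltW.
Qed.

Lemma iter_Tmap_in k x : 0 <= x <= 1 -> 0 <= iter k T x <= 1.
Proof. by move=> hx; elim: k => //= k; exact: Tmap_in. Qed.

Lemma iter_Tmap_in_pos k x : 0 < x <= 1 -> 0 < iter k T x <= 1.
Proof. by move=> hx; elim: k => //= k; exact: Tmap_in_pos. Qed.

(* Two applications of [ln u <= u - 1] give the supporting line of
   [x |-> x (-ln x)^(-b)], with slope [(-ln x)^(-b) + b (-ln x)^(-b-1)]. *)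
Lemma Tmap_left_tangent x : 0 < x <= 2^-1 ->
  exists k, forall y, 0 <= y <= 2^-1 -> T x + k * (y - x) <= T y.
Proof.
move=> hx; have /andP[x0 x2] := hx.
have lx := lt_le_trans ln2_gt0 (ln2_le_abs_ln hx).
have u0 := incr_gt0 hx; set u := incr x in u0.
exists (1 + u + u * b / `|ln x|) => y /andP[]; rewrite le_eqVlt.
have e0 : 0 <= u * b / `|ln x| by rewrite divr_ge0// mulr_ge0 ?beta_ge0// ltW.
move=> /predU1P[<- _|y0 y2].
  by rewrite Tmap0 Tmap_left// -/u; nra.
have hy : 0 < y <= 2^-1 by rewrite y0.
have ly := lt_le_trans ln2_gt0 (ln2_le_abs_ln hy).
rewrite (Tmap_left x2) (Tmap_left y2) -/u.
have -> : incr y = u * (`|ln y| / `|ln x|) `^ (- b).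
  rewrite /u /incr powRM ?invr_ge0 ?ltW// -(powR_inv1 (ltW lx)) -powRrM mulN1r opprK !powRN.
  by field; rewrite !gt_eqF// powR_gt0.
have := @powRN_tangent R (`|ln y| / `|ln x|) b (divr_gt0 ly lx) beta_ge0.
have -> : `|ln y| / `|ln x| - 1 = (ln x - ln y) / `|ln x|.
  rewrite -[X in _ - X](divff (lt0r_neq0 lx)) -mulrBl; congr (_ / _).
  by rewrite !abs_ln; lra.
set P := (_ `^ _) => hP.
have hl : y * (ln x - ln y) <= x - y.
  have := @ln_le_subr1 R (x / y); rewrite divr_gt0// ln_div ?posrE// => /(_ isT).
  move=> /(ler_wpM2l (ltW y0)) /le_trans; apply.
  by rewrite mulrBr mulrCA divff ?mulr1 ?gt_eqF.
have {}hP := ler_wpM2l (ltW (mulr_gt0 y0 u0)) hP.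
have := ler_wpM2l e0 hl; move: hP.
have -> : y * u * (1 - b * ((ln x - ln y) / `|ln x|)) =
  y * u - u * b / `|ln x| * (y * (ln x - ln y)) by ring.
by set A := u * b / `|ln x|; lra.
Qed.

(** The supporting line at the barycentre [z], averaged over the two points. It is available only
    for [z > 0]; at [z = 0] the left side is [T 0 = 0]. *)
Lemma Tmap_left_convex x y t : 0 <= x <= 2^-1 -> 0 <= y <= 2^-1 -> 0 <= t <= 1 ->
  T (t * x + (1 - t) * y) <= t * T x + (1 - t) * T y.
Proof.
move=> hx hy ht; set z := _ + _.
have hz : 0 <= z <= 2^-1 by rewrite /z; apply/andP; split; nra.
have /andP[z0 z2] := hz; have /andP[t0 t1] := ht.
have hT w : 0 <= w <= 2^-1 -> 0 <= T w.
  by move=> hw; have /andP[+ _] := Tmap_left_bounds hw; apply: le_trans; case/andP: hw.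
move: z0; rewrite le_eqVlt => /predU1P[<-|z0].
  by rewrite Tmap0 addr_ge0// mulr_ge0 ?hT//; lra.
have [|k hk] := @Tmap_left_tangent z; first by rewrite z0.
have /(ler_wpM2l t0) h1 := hk _ hx.
have /(ler_wpM2l (_ : 0 <= 1 - t)) h2 := hk _ hy.
have {h2} h2 := h2 ltac:(lra).
have -> : T z = t * (T z + k * (x - z)) + (1 - t) * (T z + k * (y - z)).
  by rewrite /z; ring.
exact: lerD.
Qed.

(* [depth] is the coordinate in which the left branch is, up to bounded
   factors, a translation. *)
Definition depth x := `|ln x| `^ gamma^-1.

(** Bounds for the depth lost in one step: at least [dmin] on the left branch, at most [dmax] on all
    of []0, 1]]. *)
Definition dmin := cT gamma / 2.
Definition dmax := cT gamma / gamma.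

Lemma gammaVE : gamma^-1 = 1 + b. Proof. by rewrite /beta; ring. Qed.

Lemma depthE x : depth x = `|ln x| * `|ln x| `^ b.
Proof.
rewrite /depth gammaVE; have [->|n0] := eqVneq `|ln x| 0.
  by rewrite mul0r powR0// gt_eqF//; have := beta_ge0; lra.
by rewrite powRD ?powRr1// n0 implybT.
Qed.

Lemma abs_ln_Tmap x : 0 < x <= 2^-1 ->
  `|ln (T x)| = `|ln x| - ln (1 + incr x).
Proof.
move=> hx; have /andP[x0 x2] := hx.
rewrite abs_ln; last by apply: Tmap_in_pos; lra.
have i0 := incr_gt0 hx.
rewrite Tmap_left// lnM ?posrE//; last by lra.
by rewrite abs_ln; lra.
Qed.

(** In [depth = |ln| * |ln|^b] the second factor at [T x] is at most the one at [x]. The loss is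
    thus at least [|ln x|^b * ln (1 + incr x)], hence at least half of
    [|ln x|^b * incr x = cT gamma]. *)
Lemma depth_Tmap_le x : 0 < x <= 2^-1 -> depth (T x) + dmin <= depth x.
Proof.
move=> hx; rewrite !depthE.
have i0 := incr_gt0 hx; have i1 := incr_le1 hx.
have l0 : 0 < 1 + incr x by lra.
have hln := @half_le_ln1D R (incr x); rewrite (ltW i0) i1 in hln.
have {}hln := hln isT.
have e := abs_ln_Tmap hx.
have le1 : `|ln (T x)| `^ b <= `|ln x| `^ b.
  by rewrite ge0_ler_powR ?beta_ge0 ?nnegrE// e; lra.
have h1 : `|ln (T x)| * `|ln (T x)| `^ b <= `|ln (T x)| * `|ln x| `^ b.
  exact: ler_wpM2l.
apply: (@le_trans _ _ (`|ln (T x)| * `|ln x| `^ b + dmin)); first by rewrite lerD2r.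
rewrite /dmin -(incr_pow hx) e.
have := ler_wpM2l (powR_ge0 `|ln x| b) hln; lra.
Qed.

Lemma dmin_gt0 : 0 < dmin. Proof. by have := cT_gt0; rewrite /dmin; lra. Qed.

Lemma dmax_gt0 : 0 < dmax. Proof. by rewrite divr_gt0 ?cT_gt0 ?gamma_gt0. Qed.

Lemma depth_ge0 x : 0 <= depth x. Proof. exact: powR_ge0. Qed.

(** On the left branch Bernoulli's inequality at the ratio [|ln (T x)| / |ln x|], with exponent
    [1 + b = gamma^-1], bounds the relative loss, and [ln (1 + incr x) <= incr x]. *)
Lemma le_depth_Tmap x : 0 < x <= 1 -> depth x <= depth (T x) + dmax.
Proof.
move=> /andP[x0 x1]; case: (leP x 2^-1) => hx2.
  have hx : 0 < x <= 2^-1 by rewrite x0.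
  have i0 := incr_gt0 hx.
  have lx := lt_le_trans ln2_gt0 (ln2_le_abs_ln hx).
  have hln : ln (1 + incr x) <= incr x by apply: le_ln1Dx; lra.
  have tE : `|ln (T x)| = `|ln x| * (`|ln (T x)| / `|ln x|).
    by rewrite mulrCA divff ?mulr1 ?gt_eqF.
  rewrite {2}/depth tE powRM// ?divr_ge0// gammaVE.
  have /(ler_wpM2l (powR_ge0 `|ln x| (1 + b))) :=
    @powR_tangent R (`|ln (T x)| / `|ln x|) b (divr_ge0 (normr_ge0 _) (normr_ge0 _)) beta_ge0.
  rewrite {1}abs_ln_Tmap// -gammaVE => hA.
  suff : gamma^-1 * (`|ln x| `^ b * ln (1 + incr x)) <= dmax.
    move: hA.
    have -> : 1 - (`|ln x| - ln (1 + incr x)) / `|ln x| = ln (1 + incr x) / `|ln x|.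
      by field; rewrite gt_eqF.
    rewrite -/(depth x) depthE.
    have -> : `|ln x| * `|ln x| `^ b * (1 - gamma^-1 * (ln (1 + incr x) / `|ln x|)) =
       `|ln x| * `|ln x| `^ b - gamma^-1 * (`|ln x| `^ b * ln (1 + incr x)).
      by field; rewrite !gt_eqF// gamma_gt0.
    by lra.
  rewrite /dmax -(incr_pow hx) mulrC (ler_wpM2r _)// ?invr_ge0 ?(ltW gamma_gt0)//.
  by rewrite ler_wpM2l// powR_ge0.
(* On the right branch [depth x] itself is small: [|ln x| <= ln 2 <= 1] gives
   [depth x <= cT gamma <= dmax]. *)
apply: (@le_trans _ _ dmax); last by rewrite lerDr depth_ge0.
rewrite depthE; have lx2 : `|ln x| <= ln 2.
  rewrite abs_ln; last by lra.
  by rewrite lerNl -ln_half ler_ln ?posrE//; lra.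
apply: (@le_trans _ _ (1 * cT gamma)).
  apply: ler_pM; rewrite ?powR_ge0//.
    by apply: le_trans lx2 _; have := @ln_le_subr1 R 2; lra.
  by rewrite ge0_ler_powR ?beta_ge0 ?nnegrE// ltW// ln2_gt0.
rewrite mul1r /dmax ler_peMr ?(ltW cT_gt0)//.
by case/andP: hgamma => g0 g1; have := invf_ge1 g0; rewrite g1.
Qed.

Lemma depth_iter_Tmap k x : 0 < x <= 1 ->
  depth x <= depth (iter k T x) + k%:R * dmax.
Proof.
move=> hx; elim: k => [|k IH]; first by rewrite mul0r addr0.
apply: le_trans IH _; have := le_depth_Tmap (iter_Tmap_in_pos k hx).
by rewrite -natr1 mulrDl mul1r /=; lra.
Qed.

(** Points of large depth form an interval at [0], so that their measure can be read off the
    distribution function. *)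
Lemma le_depth x a : 0 < x <= 1 -> 0 <= a ->
  (a <= depth x) = (x <= expR (- a `^ gamma)).
Proof.
move=> hx a0; have /andP[x0 x1] := hx; have g0 := gamma_gt0.
have -> : (a <= depth x) = (a `^ gamma <= `|ln x|).
  have e : (depth x) `^ gamma = `|ln x|.
    by rewrite /depth -powRrM mulVf ?powRr1 ?gt_eqF.
  apply/idP/idP => h.
    by rewrite -e ge0_ler_powR ?nnegrE ?depth_ge0// ltW.
  have -> : a = (a `^ gamma) `^ gamma^-1 by rewrite -powRrM divff ?powRr1 ?gt_eqF.
  by rewrite ge0_ler_powR ?nnegrE ?powR_ge0// invr_ge0 ltW.
rewrite abs_ln// lerNr -[x in RHS](lnK (_ : x \is Num.pos)) ?posrE//.
by rewrite ler_expR.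
Qed.

End dynamics.

(** * Concave functions on the unit interval *)

Definition nondecreasing01 {R : realType} (G : R -> R) :=
  forall x y, 0 <= x -> x <= y -> y <= 1 -> G x <= G y.

Definition concave01 {R : realType} (G : R -> R) :=
  forall x y t, 0 <= x <= 1 -> 0 <= y <= 1 -> 0 <= t <= 1 ->
    t * G x + (1 - t) * G y <= G (t * x + (1 - t) * y).

Section concave01.
Context {R : realType}.
Implicit Types G : R -> R.

Lemma conv01 (x y t : R) : 0 <= x <= 1 -> 0 <= y <= 1 -> 0 <= t <= 1 ->
  0 <= t * x + (1 - t) * y <= 1.
Proof. by move=> hx hy ht; apply/andP; split; nra. Qed.

Lemma concave01_scale G (x t : R) :
  concave01 G -> 0 <= G 0 -> 0 <= x <= 1 -> 0 <= t <= 1 ->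
  t * G x <= G (t * x).
Proof.
move=> cG G0 hx ht; have h0 : 0 <= (0 : R) <= 1 by lra.
have := cG x 0 t hx h0 ht; rewrite mulr0 addr0; apply: le_trans.
by rewrite lerDl mulr_ge0//; lra.
Qed.

(** Add the scaling inequality for the two multiples [x] and [y - x] of [y], with factors [x / y]
    and [1 - x / y]. *)
Lemma concave01_subadd G (x y : R) : concave01 G -> G 0 = 0 ->
  0 <= x -> x <= y -> y <= 1 -> G y - G x <= G (y - x).
Proof.
move=> cG G0 x0; rewrite le_eqVlt => /predU1P[->|xy] y1; first by rewrite !subrr G0.
have y0 : 0 < y by lra.
have hy : 0 <= y <= 1 by lra.
have ht : 0 <= x / y <= 1 by rewrite (divr_ge0 x0 (ltW y0)) ler_pdivrMr// mul1r ltW.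
have ht' : 0 <= 1 - x / y <= 1 by lra.
have G0' : 0 <= G 0 by rewrite G0.
have h1 := concave01_scale cG G0' hy ht.
have := concave01_scale cG G0' hy ht'.
have e : (1 - x / y) * y = y - x by field; rewrite gt_eqF.
rewrite e; rewrite divfK ?gt_eqF// in h1.
by rewrite mulrBl mul1r; lra.
Qed.

(** For a distribution function this bounds the mass of []1/2, psi1 z]]. Since [1/2] lies between
    [0] and [(1 + z) / 2] with weight [t = z / (1 + z)] on [0], concavity gives
    [G ((1 + z) / 2) <= (1 + z) * G (1/2)], and [G (1/2) <= G 1]. *)
Lemma concave01_half G (z : R) : concave01 G -> nondecreasing01 G -> 0 <= G 0 -> 0 <= z <= 1 ->
  G ((1 + z) / 2) - G 2^-1 <= z * G 1.
Proof.
move=> cG mG G0 /andP[z0 z1].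
have h01 : G 2^-1 <= G 1 by apply: mG; lra.
have h0h : G 0 <= G 2^-1 by apply: mG; lra.
pose t := z / (1 + z); have ht : 0 <= t <= 1.
  by rewrite /t divr_ge0 ?addr_ge0//= ler_pdivrMr//; lra.
have := @cG 0 ((1 + z) / 2) t _ _ ht; rewrite mulr0 add0r.
have -> : (1 - t) * ((1 + z) / 2) = 2^-1 by rewrite /t; field; lra.
move=> h; have {}h : t * G 0 + (1 - t) * G ((1 + z) / 2) <= G 2^-1 by apply: h; lra.
have tG : 0 <= t * G 0 by rewrite mulr_ge0//; lra.
have -> : G ((1 + z) / 2) = (1 + z) * ((1 - t) * G ((1 + z) / 2)).
  by rewrite /t; field; lra.
have : (1 + z) * ((1 - t) * G ((1 + z) / 2)) <= (1 + z) * G 2^-1.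
  by rewrite ler_wpM2l//; lra.
have : z * G 2^-1 <= z * G 1 by rewrite ler_wpM2l.
lra.
Qed.

Lemma concave01_comp G H : concave01 G -> nondecreasing01 G -> concave01 H ->
  (forall x, 0 <= x <= 1 -> 0 <= H x <= 1) -> concave01 (G \o H).
Proof.
move=> cG mG cH hH x y t hx hy ht /=.
apply: le_trans (cG _ _ _ (hH _ hx) (hH _ hy) ht) _.
have := conv01 (hH _ hx) (hH _ hy) ht => /andP[h0 _].
have /andP[_ h1] := hH _ (conv01 hx hy ht).
by apply: mG => //; exact: cH.
Qed.

End concave01.

(** * Inverse branches of [T] and of its iterates *)

Section left_inverse.
Context {R : realType} (gamma : R) (hgamma : 0 < gamma <= 1).
Implicit Types x y z : R.

Local Notation T := (Tmap gamma).

(** The inverse of the left branch, obtained by choice; it is meaningful on [[0, 1]] and takes the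
    default value [0] where no preimage exists. *)
Definition psi0 y := xget 0 [set x | 0 <= x <= 2^-1 /\ T x = y].
Definition psi1 y : R := (1 + y) / 2.

(** Intermediate values on [[y / 4, 1/2]]: [T (y / 4) <= y / 2], [T (1/2) = 1], and the interval
    stays away from the singularity of [ln] at [0]. *)
Lemma Tmap_left_surj y : 0 <= y <= 1 -> exists x, 0 <= x <= 2^-1 /\ T x = y.
Proof.
move=> /andP[]; rewrite le_eqVlt => /predU1P[<- _|y0 y1].
  by exists 0; split; [lra | exact: Tmap0].
(* Agrees with [T] on []0, 1/2]], and is built from functions whose continuity there is
   immediate. *)
pose g (x : R) := x * (1 + cT gamma * expR (- beta gamma * ln (- ln x))).
have gE x : 0 < x <= 2^-1 -> g x = T x.
  move=> hx; have lx := lt_le_trans ln2_gt0 (ln2_le_abs_ln hx).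
  have x2 : x <= 2^-1 by case/andP: hx.
  rewrite Tmap_left// /g /incr -powRN /powR gt_eqF//.
  by rewrite abs_ln//; lra.
have cg : {within `[y / 4, 2^-1], continuous g}.
  apply: continuous_in_subspaceT => x; rewrite inE/= in_itv/= => hx.
  have x0 : 0 < x by lra.
  have lx : 0 < - ln x.
    have h : 0 < x <= 2^-1 by lra.
    by have := lt_le_trans ln2_gt0 (ln2_le_abs_ln h); rewrite abs_ln//; lra.
  apply: cvgM; first exact: cvg_id.
  apply: cvgD; first exact: cvg_cst.
  apply: cvgM; first exact: cvg_cst.
  apply: (@continuous_comp _ _ _ (fun u : R => - beta gamma * ln (- ln u)) expR);
    last exact: continuous_expR.
  apply: cvgM; first exact: cvg_cst.
  apply: (@continuous_comp _ _ _ (fun u : R => - ln u) (@ln R)).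
    by apply: cvgN; exact: continuous_ln.
  exact: continuous_ln.
have h2 : 0 < (2^-1 : R) <= 2^-1 by lra.
have h4 : 0 < y / 4 <= 2^-1 by lra.
have g2 : g 2^-1 = 1 by rewrite gE// Tmap_half.
have g4 : g (y / 4) <= y.
  rewrite gE//; have /andP[_] : y / 4 <= T (y / 4) <= 2 * (y / 4).
    by apply: (@Tmap_left_bounds _ _ hgamma); lra.
  by lra.
have [||x] := @IVT R g (y / 4) 2^-1 y _ cg; first by lra.
  by rewrite g2 ge_min g4 le_max y1 orbT.
rewrite in_itv/= => hx <-; exists x; split; first by lra.
by rewrite gE//; lra.
Qed.

Lemma psi0P y : 0 <= y <= 1 -> 0 <= psi0 y <= 2^-1 /\ T (psi0 y) = y.
Proof.
move=> hy; rewrite /psi0; case: xgetP => [x _ []//|h].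
by have [x /h] := Tmap_left_surj hy.
Qed.

Lemma psi0_in y : 0 <= y <= 1 -> 0 <= psi0 y <= 2^-1.
Proof. by move=> /psi0P[]. Qed.

Lemma Tmap_psi0 y : 0 <= y <= 1 -> T (psi0 y) = y.
Proof. by move=> /psi0P[]. Qed.

Lemma Tmap_le x y : 0 <= x <= 2^-1 -> 0 <= y <= 1 -> (T x <= y) = (x <= psi0 y).
Proof.
move=> /andP[x0 x2] hy; have /andP[p0 p2] := psi0_in hy.
rewrite -{1}(Tmap_psi0 hy); case: (ltgtP x (psi0 y)) => [h|h|<-].
- by rewrite ltW// (Tmap_left_lt hgamma).
- by apply/negbTE; rewrite -ltNge (Tmap_left_lt hgamma).
- by rewrite lexx.
Qed.

Lemma psi0_0 : psi0 0 = 0.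
Proof.
have h0 : 0 <= (0 : R) <= 1 by lra.
have /andP[p0 p2] := psi0_in h0.
have := Tmap_left_bounds hgamma (psi0_in h0); rewrite Tmap_psi0//; lra.
Qed.

Lemma psi0_1 : psi0 1 = 2^-1.
Proof.
have h1 : 0 <= (1 : R) <= 1 by lra.
have /andP[p0 p2] := psi0_in h1.
apply/le_anti; rewrite p2 -Tmap_le//; last by lra.
by rewrite Tmap_half lexx.
Qed.

Lemma psi0_gt0 y : 0 < y <= 1 -> 0 < psi0 y <= 2^-1.
Proof.
move=> hy; have hy' : 0 <= y <= 1 by lra.
have /andP[p0 ->] := psi0_in hy'; rewrite andbT lt_neqAle p0 andbT.
by apply/eqP => h; have := Tmap_psi0 hy'; rewrite -h Tmap0; lra.
Qed.

Lemma psi0_nd : nondecreasing01 psi0.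
Proof.
move=> x y x0 xy y1; have hx : 0 <= x <= 1 by lra.
rewrite -Tmap_le ?psi0_in//; last by lra.
by rewrite Tmap_psi0.
Qed.

Lemma psi0_in01 y : 0 <= y <= 1 -> 0 <= psi0 y <= 1.
Proof. by move=> /psi0_in; lra. Qed.

Lemma psi0_concave : concave01 psi0.
Proof.
move=> x y t hx hy ht.
have px := psi0_in hx; have py := psi0_in hy.
have hc : 0 <= t * psi0 x + (1 - t) * psi0 y <= 2^-1 by apply/andP; split; nra.
rewrite -Tmap_le ?conv01//.
apply: le_trans (Tmap_left_convex hgamma px py ht) _.
by rewrite !Tmap_psi0.
Qed.

Lemma psi1_in01 y : 0 <= y <= 1 -> 0 <= psi1 y <= 1.
Proof. by rewrite /psi1; lra. Qed.

Lemma psi1_concave : concave01 psi1.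
Proof. by move=> x y t _ _ _; rewrite /psi1; lra. Qed.

Lemma half_le_psi0 y : 0 <= y <= 1 -> y / 2 <= psi0 y.
Proof.
move=> hy; have h1 : 0 <= (1 : R) <= 1 by lra.
have p0 : 0 <= psi0 0 by rewrite psi0_0.
have := concave01_scale psi0_concave p0 h1 hy.
by rewrite psi0_1 mulr1.
Qed.

Lemma iter_psi0_in N y : 0 <= y <= 1 -> 0 <= iter N psi0 y <= 1.
Proof. by move=> hy; elim: N => //= N IH; exact: psi0_in01. Qed.

Lemma depth_iter_psi0 N y : 0 < y <= 1 ->
  0 < iter N psi0 y <= 1 /\ N%:R * dmin gamma <= depth gamma (iter N psi0 y).
Proof.
move=> hy; elim: N => [|N [h1 h2]] /=; first by rewrite mul0r depth_ge0.
have hp := psi0_gt0 h1; split; first by lra.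
have h1' : 0 <= iter N psi0 y <= 1 by lra.
have := depth_Tmap_le hgamma hp; rewrite Tmap_psi0//.
by rewrite -natr1 mulrDl; lra.
Qed.

(** Each application of [psi0] adds at least [dmin] to the depth, whatever the point, so the
    convergence to [0] is uniform. *)
Lemma iter_psi0_small e : 0 < e -> exists N, forall y, 0 <= y <= 1 -> iter N psi0 y <= e.
Proof.
move=> e0; have g0 := gamma_gt0 hgamma; have d0 := @dmin_gt0 _ gamma.
pose a := `|ln e| `^ gamma^-1.
have a0 : 0 <= a by exact: powR_ge0.
exists (Num.truncn (a / dmin gamma)).+1 => y /andP[]; set N := _.+1.
rewrite le_eqVlt => /predU1P[<- _|y0 y1].
  have -> : iter N psi0 0 = 0 by elim: N => //= N ->; exact: psi0_0.
  exact: ltW.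
have [h1 h2] := @depth_iter_psi0 N y ltac:(lra).
have : a <= depth gamma (iter N psi0 y).
  apply: le_trans h2; rewrite -ler_pdivrMr// ltW//.
  by have := truncnS_gt (a / dmin gamma).
rewrite le_depth// /a -powRrM mulVf ?gt_eqF// powRr1// => /le_trans; apply.
rewrite -[leRHS]lnK ?posrE// ler_expR lerNl.
by rewrite -normrN ler_norm.
Qed.

(** The [2^N] inverse branches of the [N]-th iterate of [T]; their images of [[0, 1]] are the
    cylinders of length [N]. *)
Fixpoint branches N : seq (R -> R) :=
  if N is N'.+1 then
    [seq psi0 \o f | f <- branches N'] ++ [seq psi1 \o f | f <- branches N']
  else [:: id].

Lemma big_branchesS N (X : (R -> R) -> R) :
  \sum_(f <- branches N.+1) X f =
  \sum_(f <- branches N) (X (psi0 \o f) + X (psi1 \o f)).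
Proof. by rewrite /= big_cat !big_map big_split. Qed.

(** The last clause says that no cylinder is longer than the one at [0]. An outer [psi0] is handled
    by subadditivity of a concave function vanishing at [0], an outer [psi1] by
    [y / 2 <= psi0 y]. *)
Lemma branchesP N (f : R -> R) : List.In f (branches N) ->
  [/\ forall y, 0 <= y <= 1 -> 0 <= f y <= 1, nondecreasing01 f, concave01 f &
      forall y, 0 <= y <= 1 -> f y - f 0 <= iter N psi0 y].
Proof.
elim: N f => [|N IH] f /=.
  by case=> // <-; split => // y hy; rewrite subr0.
have h0 : 0 <= (0 : R) <= 1 by lra.
move=> /(@List.in_app_or _ _ _ _) [] /(proj1 (@List.in_map_iff _ _ _ _ _)).
  case=> g [<- /IH[g01 gnd gc gi]]; split.
  - by move=> y hy; exact/psi0_in01/g01.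
  - move=> x y x0 xy y1 /=; apply: psi0_nd.
    + by have /andP[] : 0 <= g x <= 1 by apply: g01; lra.
    + exact: gnd.
    + by have /andP[] : 0 <= g y <= 1 by apply: g01; lra.
  - exact: concave01_comp psi0_concave psi0_nd gc g01.
  - move=> y hy /=; have /andP[y0 y1] := hy.
    have /andP[gy0 gy1] := g01 y hy; have /andP[g00 g0_1] := g01 0 h0.
    apply: le_trans (concave01_subadd psi0_concave psi0_0 g00 (gnd _ _ (lexx _) y0 y1) gy1) _.
    apply: psi0_nd; last by have /andP[] := iter_psi0_in N hy.
      by rewrite subr_ge0 gnd.
    exact: gi.
case=> g [<- /IH[g01 gnd gc gi]]; split.
- by move=> y hy; exact/psi1_in01/g01.
- by move=> x y x0 xy y1 /=; have := gnd _ _ x0 xy y1; rewrite /psi1; lra.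
- apply: concave01_comp psi1_concave _ gc g01.
  by move=> x y x0 xy y1; rewrite /psi1; lra.
- move=> y hy /=; have h := gi y hy.
  have := half_le_psi0 (iter_psi0_in N hy); rewrite /psi1; lra.
Qed.

(** The hypothesis is invariance written for a distribution function: replacing a branch by its two
    preimages leaves the sum of the increments unchanged. *)
Lemma sum_branches_fixed N (F : R -> R) z : 0 <= z <= 1 ->
  (forall y, 0 <= y <= 1 -> F (psi0 y) + F (psi1 y) = F y + F 2^-1) ->
  \sum_(f <- branches N) (F (f z) - F (f 0)) = F z - F 0.
Proof.
move=> hz hF; elim: N => [|N IH]; first by rewrite /= big_seq1.
rewrite big_branchesS -IH.
suff h : forall f, List.In f (branches N) ->
  F ((psi0 \o f) z) - F ((psi0 \o f) 0) + (F ((psi1 \o f) z) - F ((psi1 \o f) 0)) =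
  F (f z) - F (f 0).
  elim: (branches N) h => [|f s IHs] h; first by rewrite !big_nil.
  by rewrite !big_cons h ?IHs//= => [g hg|]; [apply: h; right | left].
move=> f /branchesP[f01 _ _ _] /=.
have h0 : 0 <= (0 : R) <= 1 by lra.
by have := hF _ (f01 _ hz); have := hF _ (f01 _ h0); lra.
Qed.

(** Here [K] is arbitrary: the cylinders tile [[0, 1]], because [psi0 1 = psi1 0 = 1/2]. *)
Lemma sum_branches_telescope N (K : R -> R) :
  \sum_(f <- branches N) (K (f 1) - K (f 0)) = K 1 - K 0.
Proof.
elim: N K => [|N IH] K; first by rewrite /= big_seq1.
rewrite big_branchesS big_split /= (IH (K \o psi0)) (IH (K \o psi1)) /=.
rewrite psi0_0 psi0_1 /psi1; have -> : (1 + 1) / 2 = 1 :> R by lra.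
have -> : (1 + 0) / 2 = 2^-1 :> R by lra.
by ring.
Qed.

End left_inverse.

(** * Local linear approximation of an absolutely continuous distribution function *)

Section concave_cdf.
Context {R : realType}.
Local Notation mu := (@lebesgue_measure R).

(** Compactness, as a near covering along [0^'+], yields one modulus for all [x]; the point [y] may
    leave the segment. *)
Lemma continuous_unif_segment (g : R -> R) : continuous g ->
  forall e, 0 < e -> exists2 d, 0 < d &
    forall x y, 0 <= x <= 1 -> `|y - x| <= d -> `|g y - g x| <= e.
Proof.
move=> cg e e0.
have nc : near_covering `[(0 : R), (1 : R)]%classic.
  by apply/compact_near_coveringP; exact: segment_compact.
pose P (d x : R) := forall y : R, `|y - x| <= d -> `|g y - g x| <= e.
have h := nc R (0^'+) P _.
have {h} hn : \forall d \near 0^'+, `[(0 : R), (1 : R)]%classic `<=` P d.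
  apply: h => x _.
  have e2 : 0 < e / 2 by lra.
  have /cvgrPdist_lt/(_ _ e2)/nbhs_ballP[r /= r0 hr] := cg x.
  exists (ball x (r / 2), [set d : R | 0 < d < r / 2]) => /=.
    split; first by apply: nbhsx_ballx; lra.
    near=> d => /=; apply/andP; split; near: d; first exact: nbhs_right_gt.
    by apply: nbhs_right_lt; lra.
  move=> [x' d] /= [bx' /andP[d0 dr]] y hy.
  rewrite /ball/= in bx' hr.
  have h1 : `|g x - g x'| < e / 2 by apply: hr; lra.
  have h2 : `|g x - g y| < e / 2.
    apply: hr; have -> : x - y = (x - x') - (y - x') by ring.
    by apply: le_lt_trans (ler_normB _ _) _; lra.
  have -> : g y - g x' = (g x - g x') - (g x - g y) by ring.
  by apply: le_trans (ler_normB _ _) _; lra.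
near (0:R)^'+ => d; exists d; first by near: d; exact: nbhs_right_gt.
move=> x y hx hy.
have : `[(0 : R), (1 : R)]%classic `<=` P d by near: d; exact: hn.
by apply => //=; rewrite in_itv.
Unshelve. all: by end_near.
Qed.

Context (nu : probability (measurableTypeR R) R).

Definition cdf01 (z : R) : R := fine (nu `[0, z]%classic).

Lemma cdf01_nd : nondecreasing01 cdf01.
Proof.
move=> x y x0 xy y1; apply: fine_le; rewrite ?fin_num_measure//.
apply: le_measure; rewrite ?inE//.
by apply: subset_itvl; rewrite bnd_simp.
Qed.

(** The density [h] is approximated in [L^1] by a continuous [g], which is almost constant at scale
    [d]. The error is the increment of a nondecreasing [K], so that errors over disjoint intervals
    add up to at most [eps]. *)
Lemma ac_local_slope : nu `<< mu -> forall eps, 0 < eps ->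
  exists d (K a : R -> R), [/\ 0 < d, nondecreasing01 K, K 1 - K 0 <= eps,
    forall x, 0 <= a x &
    forall x y, 0 <= x -> x <= y -> y <= 1 -> y - x <= d ->
      `|cdf01 y - cdf01 x - a x * (y - x)| <= K y - K x].
Proof.
move=> ac eps eps0.
have [f [f0 ffin fint fE]] := radon_nikodym_sigma_finite ac.
pose h x := fine (f x).
have h0 x : 0 <= h x by exact: fine_ge0.
have hf : EFin \o h = f by apply/funext => x /=; rewrite fineK.
have hint : mu.-integrable setT (EFin \o h) by rewrite hf.
have hintS A : measurable A -> mu.-integrable A (EFin \o h).
  by move=> mA; apply: integrableS hint.
have mI : mu `[0%R, 1%R]%classic = 1%E.
  by rewrite lebesgue_measure_itv/= lte01 oppr0 adde0.
have mU : measurable (`[0%R, 1%R]%classic : set (measurableTypeR R)) by [].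
have mUfin : (mu `[0%R, 1%R]%classic < +oo)%E by rewrite mI ltry.
have [g_ [cg ig g_cvg]] := approximation_continuous_integrable mU mUfin (hintS _ mU).
have eps2 : 0 < eps / 2 by lra.
have [n hn] : exists n, (\int[mu]_(z in `[0%R, 1%R]) `|(h z - g_ n z)%:E| < (eps / 2)%:E)%E.
  have := g_cvg [set y | (y < (eps / 2)%:E)%E].
  move=> /(_ (@nbhs_open_ereal_lt _ 0 (fun=> eps / 2) eps2)) [n _ hn].
  by exists n; apply: hn => /=.
set g := g_ n in hn; have {}cg : continuous g := cg n.
have {}ig : mu.-integrable `[0%R, 1%R] (EFin \o g) := ig n.
have iD : mu.-integrable `[0%R, 1%R] (EFin \o (fun z => `|h z - g z|)).
  apply: integrable_norm; exact: (integrableB mU (hintS _ mU) ig).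
have [d d0 hd] := continuous_unif_segment cg eps2.
(* Half of [eps] pays for the [L^1] distance from [h] to [g], the other half for the oscillation of
   [g]. *)
pose K z := \int[mu]_(t in `[0, z]) `|h t - g t| + eps / 2 * z.
have subU x y : 0 <= x -> y <= 1 -> `]x, y]%classic `<=` `[(0:R), (1:R)]%classic.
  by move=> x0 y1; apply: subset_itv; rewrite bnd_simp.
have iDxy x y : 0 <= x -> y <= 1 ->
    mu.-integrable `]x, y] (EFin \o (fun z => `|h z - g z|)).
  by move=> x0 y1; apply: integrableS iD => //; exact: subU.
have KB x y : 0 <= x -> x <= y -> y <= 1 ->
    K y - K x = \int[mu]_(t in `]x, y]) `|h t - g t| + eps / 2 * (y - x).
  move=> x0 xy y1; rewrite -(@Rintegral_itvB _ _ (BLeft 0) (BRight y)); last 3 first.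
  - apply: integrableS iD => //; apply: subset_itv; rewrite bnd_simp//.
  - by rewrite bnd_simp.
  - by rewrite bnd_simp.
  by rewrite /K; ring.
have FB x y : 0 <= x -> x <= y -> y <= 1 ->
    cdf01 y - cdf01 x = \int[mu]_(t in `]x, y]) h t.
  move=> x0 xy y1; rewrite -(@Rintegral_itvB _ _ (BLeft 0) (BRight y)); last 3 first.
  - exact: hintS.
  - by rewrite bnd_simp.
  - by rewrite bnd_simp.
  by rewrite /cdf01 /Rintegral !fE// -hf.
(* Truncating the slope at [0] does not increase the error, the density being nonnegative. *)
exists d, K, (fun x => Num.max (g x) 0); split => //.
- move=> x y x0 xy y1; rewrite -subr_ge0 KB// addr_ge0//.
    by apply: Rintegral_ge0 => t _.
  by rewrite mulr_ge0 ?subr_ge0// ltW.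
- rewrite KB// subr0 mulr1; suff : \int[mu]_(t in `]0, 1]) `|h t - g t| <= eps / 2 by lra.
  rewrite Rintegral_itv_obnd_cbnd; last exact: iDxy.
  rewrite -lee_fin /Rintegral fineK; last exact: integrable_fin_num.
  exact: ltW.
- by move=> x; rewrite le_max lexx orbT.
- move=> x y x0 xy y1 yx; rewrite FB// KB//.
  set a := Num.max _ _; set I := `]x, y].
  have muI : mu [set` I] = (y - x)%:E.
    rewrite lebesgue_measure_itv/= lte_fin; move: xy.
    by rewrite le_eqVlt => /predU1P[->|->//]; rewrite ltxx subrr.
  have icst c : mu.-integrable [set` I] (EFin \o (fun=> c : R)).
    apply: measurable_bounded_integrable => //.
      by apply: (@le_lt_trans _ _ (y - x)%:E); rewrite ?ltry// -muI.
    exact: bounded_cst.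
  have mxy : measurable ([set` I] : set (measurableTypeR R)) by [].
  have hI := hintS [set` I] mxy.
  have -> : a * (y - x) = \int[mu]_(t in [set` I]) a.
    by rewrite Rintegral_cst//; have /(congr1 fine)/= -> := muI.
  have -> : eps / 2 * (y - x) = \int[mu]_(t in [set` I]) (eps / 2).
    by rewrite Rintegral_cst//; have /(congr1 fine)/= -> := muI.
  rewrite -RintegralB// -RintegralD//; last exact: iDxy.
  have ia : mu.-integrable [set` I] (EFin \o (fun t => h t - a)).
    exact: (integrableB mxy hI (icst a)).
  apply: le_trans (le_normr_Rintegral _ ia) _ => //.
  apply: le_Rintegral => //.
  + exact: integrable_norm.
  + exact: (integrableD mxy (iDxy _ _ x0 y1) (icst _)).
  + move=> t; rewrite /I /= in_itv/= => /andP[xt ty].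
    have hx : 0 <= x <= 1 by lra.
    have htx : `|t - x| <= d by rewrite ger0_norm; lra.
    have := hd x t hx htx; have h0t := h0 t; rewrite /a.
    have := ler_norm (h t - g t); have := ler_norm (- (h t - g t)).
    rewrite normrN => h1 h2; rewrite ler_norml => /andP[h3 h4].
    by rewrite ler_norml; case: (lerP (g x) 0) => g0; apply/andP; split; lra.
Qed.

End concave_cdf.

(** * Measurability of the map, its iterates and the depth *)

Section measurable_dynamics.
Context {R : realType} (gamma : R).

Lemma measurable_incr : measurable_fun setT (@incr R gamma).
Proof.
apply: measurable_funM; first exact: measurable_cst.
under eq_fun do rewrite -powRN.
apply: (@measurableT_comp _ _ _ _ _ _ (@powR R ^~ _)); first exact: measurable_powR.
by apply: measurableT_comp; [exact: normr_measurable|exact: measurable_ln].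
Qed.

Lemma measurable_Tmap :
  measurable_fun (setT : set (measurableTypeR R)) (Tmap gamma : R -> measurableTypeR R).
Proof.
have -> : Tmap gamma = fun x : R => if x <= 2^-1 then x * (1 + incr gamma x) else 2 * x - 1.
  apply/funext => x; case: ifPn => [/Tmap_left->//|]; rewrite -ltNge.
  exact: Tmap_right.
apply: measurable_fun_ifT => /=.
- by apply: measurable_fun_ler.
- apply: measurable_funM => //; apply: measurable_funD => //; exact: measurable_incr.
- by apply: measurable_funB => //; exact: measurable_funM.
Qed.

Lemma measurable_iter_Tmap k :
  measurable_fun (setT : set (measurableTypeR R)) (iter k (Tmap gamma) : R -> measurableTypeR R).
Proof.
elim: k => [|k IH]; first exact: measurable_id.
exact: measurableT_comp measurable_Tmap IH.
Qed.

Lemma measurable_depth : measurable_fun setT (@depth R gamma).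
Proof.
apply: (@measurableT_comp _ _ _ _ _ _ (@powR R ^~ _)); first exact: measurable_powR.
by apply: measurableT_comp; [exact: normr_measurable|exact: measurable_ln].
Qed.

End measurable_dynamics.

Lemma ler_sum_In (T : Type) (R : numDomainType) (s : seq T) (X Y : T -> R) :
  (forall f, List.In f s -> X f <= Y f) -> \sum_(f <- s) X f <= \sum_(f <- s) Y f.
Proof.
elim: s => [|f s IH] h; first by rewrite !big_nil.
rewrite !big_cons lerD//; first by apply: h; left.
by apply: IH => g hg; apply: h; right.
Qed.

(** * Concavity of the distribution function of the invariant measure *)

Section invariant_measure.
Context {R : realType} (gamma : R) (hgamma : 0 < gamma <= 1).
Local Notation T := (Tmap gamma).
Local Notation psi0 := (psi0 gamma).

(** Write [F z - F 0] as a sum of increments over cylinders shorter than [d] and linearise each one.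
    The outcome is a combination of concave branches with nonnegative coefficients, and the tiling
    bounds the total error by [K 1 - K 0]. Concavity survives the limit. *)
Lemma local_slope_concave (F : R -> R) :
  (forall y, 0 <= y <= 1 -> F (psi0 y) + F (psi1 y) = F y + F 2^-1) ->
  (forall eps, 0 < eps -> exists d (K a : R -> R),
    [/\ 0 < d, nondecreasing01 K, K 1 - K 0 <= eps, forall x, 0 <= a x &
    forall x y, 0 <= x -> x <= y -> y <= 1 -> y - x <= d ->
      `|F y - F x - a x * (y - x)| <= K y - K x]) -> concave01 F.
Proof.
move=> hF happ x y t hx hy ht; apply/ler_addgt0Pr => e e0.
have e2 : 0 < e / 2 by lra.
have [d [K [a [d0 Knd K1 a0 hK]]]] := happ _ e2.
have [N hN] := iter_psi0_small hgamma d0.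
have h0 : 0 <= (0 : R) <= 1 by lra.
pose S z := \sum_(f <- branches gamma N) a (f 0) * (f z - f 0).
have hS z : 0 <= z <= 1 -> `|F z - F 0 - S z| <= e / 2.
  move=> hz; rewrite -(sum_branches_fixed hgamma N hz hF) /S -sumrB.
  apply: le_trans (ler_norm_sum _ _ _) _.
  apply: le_trans K1; rewrite -(sum_branches_telescope hgamma N K).
  apply: ler_sum_In => f /(branchesP hgamma)[f01 fnd _ fi].
  have /andP[z0 z1] := hz.
  have /andP[f00 f0_1] := f01 0 h0.
  have /andP[fz0 fz1] := f01 z hz.
  have h1 : f 0 <= f z by apply: fnd.
  apply: le_trans (hK _ _ f00 h1 fz1 _) _.
    exact: le_trans (fi z hz) (hN z hz).
  rewrite lerD2r; apply: Knd => //; first exact: fnd.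
  by have /andP[] : 0 <= f 1 <= 1 by apply: f01; lra.
have Sc : t * S x + (1 - t) * S y <= S (t * x + (1 - t) * y).
  rewrite /S !mulr_sumr -big_split /=; apply: ler_sum_In => f /(branchesP hgamma)[_ _ fc _].
  have := ler_wpM2l (a0 (f 0)) (fc _ _ _ hx hy ht); set u := f (_ + _); lra.
have := hS _ (conv01 hx hy ht); rewrite ler_norml => /andP[h1 h2].
have := hS _ hy; rewrite ler_norml => /andP[h3 h4].
have := hS _ hx; rewrite ler_norml => /andP[h5 h6].
have t0 : 0 <= t by lra. have t1 : 0 <= 1 - t by lra.
have h6' : F x <= S x + F 0 + e / 2 by lra.
have h4' : F y <= S y + F 0 + e / 2 by lra.
have := ler_wpM2l t0 h6'; have := ler_wpM2l t1 h4'; lra.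
Qed.

Context (nu : probability (measurableTypeR R) R) (hnu : invariant_acpm gamma nu).
Local Notation F := (cdf01 nu).

Lemma iter_invariant k (A : set (measurableTypeR R)) : measurable A -> A `<=` unitI ->
  nu (unitI `&` iter k T @^-1` A) = nu A.
Proof.
case: hnu => _ _ inv mA AU; elim: k => [|k IH].
  by congr (nu _); apply/seteqP; split => x /= => [[]//|Ax]; split => //; exact: AU.
rewrite -IH -(inv (unitI `&` iter k T @^-1` A)).
- congr (nu _); apply/seteqP; split => x /=; rewrite -iterSr.
    move=> [Ux Ax]; do ![split => //].
    by move: Ux; rewrite /unitI/= !in_itv/=; exact: Tmap_in.
  by move=> [Ux [_ Ax]].
- apply: measurableI; first exact: measurable_itv.
  by have := measurable_iter_Tmap gamma k measurableT mA; rewrite setTI.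
- exact: subIsetl.
Qed.

Lemma cdf01_0 : F 0 = 0.
Proof.
case: hnu => _ /null_content_dominatesP ac _.
have l0 : @lebesgue_measure R `[0, 0]%classic = 0%E by rewrite lebesgue_measure_itv/= ltxx.
by rewrite /cdf01 (ac _ (measurable_itv _) l0).
Qed.

Lemma cdf01_1 : F 1 = 1.
Proof. by case: hnu => + _ _; rewrite /unitI /cdf01 => ->. Qed.

Lemma EFin_cdf01 z : (F z)%:E = nu `[0, z]%classic.
Proof. by rewrite fineK// fin_num_measure. Qed.

Lemma cdf01_itv x y : 0 <= x -> x <= y -> nu `]x, y]%classic = (F y - F x)%:E.
Proof.
move=> x0 xy; rewrite EFinB !EFin_cdf01.
have -> : `[0, y]%classic = `[0, x]%classic `|` `]x, y]%classic.
  by rewrite -itv_bndbnd_setU// bnd_simp.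
rewrite measureU//; first by rewrite addeAC subee ?add0e// fin_num_measure.
by apply/seteqP; split => z //=; rewrite !in_itv/= => -[]; lra.
Qed.

(** Invariance tested on [[0, z]], whose preimage is the union of [[0, psi0 z]] and []1/2, psi1
    z]]. *)
Lemma cdf01_invariant z : 0 <= z <= 1 -> F (psi0 z) + F (psi1 z) = F z + F 2^-1.
Proof.
move=> hz; have /andP[p0 p2] := psi0_in hgamma hz.
have h2 : (2^-1 : R) <= psi1 z by rewrite /psi1; lra.
have e : nu `[0, z]%classic = (F (psi0 z) + (F (psi1 z) - F 2^-1))%:E.
  case: hnu => _ _ <- //; last by apply: subset_itvl; rewrite bnd_simp; case/andP: hz.
  have h0 : 0 <= (2^-1 : R) by lra.
  have e1 := EFin_cdf01 (psi0 z); have e2 := cdf01_itv h0 h2.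
  rewrite EFinD e1 -e2.
  rewrite -measureU//; last first.
    by apply/seteqP; split => x //=; rewrite !in_itv/= => -[]; lra.
  congr (nu _); apply/seteqP; split => x /=; rewrite /unitI/= !in_itv/=.
    move=> [hx /andP[_]]; case: (leP x 2^-1) => x2.
      by rewrite (Tmap_le hgamma) => //; [move=> h; left; lra | lra].
    by rewrite Tmap_right// => h; right; rewrite /psi1; lra.
  case=> [hx|]; last rewrite /psi1 => hx.
    split; first by lra.
    have hx2 : 0 <= x <= 2^-1 by lra.
    have hx1 : 0 <= x <= 1 by lra.
    rewrite (Tmap_le hgamma)//.
    by have /andP[-> _] := Tmap_in hgamma hx1; case/andP: hx.
  by split; [lra | rewrite Tmap_right; lra].
by move: e; rewrite -EFin_cdf01 => -[->]; ring.
Qed.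

Lemma cdf01_concave : concave01 F.
Proof.
apply: local_slope_concave => [y hy|]; first exact: cdf01_invariant.
by case: hnu => _ ac _; exact: ac_local_slope.
Qed.

Lemma le_cdf01 z : 0 <= z <= 1 -> z <= F z.
Proof.
move=> hz; have h1 : 0 <= (1 : R) <= 1 by lra.
have F0 : 0 <= F 0 by rewrite cdf01_0.
by have := concave01_scale cdf01_concave F0 h1 hz; rewrite cdf01_1 !mulr1.
Qed.

Lemma cdf01_psi0 z : 0 <= z <= 1 -> F z <= F (psi0 z) + z.
Proof.
move=> hz; have F0 : 0 <= F 0 by rewrite cdf01_0.
have := concave01_half cdf01_concave (@cdf01_nd _ nu) F0 hz.
by rewrite cdf01_1 mulr1; have := cdf01_invariant hz; rewrite /psi1; lra.
Qed.

End invariant_measure.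

(** * Weighted transfer operators and exponential moments *)

Section exponential_weights.
Context {R : realType} (gamma : R) (hgamma : 0 < gamma <= 1).
Context (nu : probability (measurableTypeR R) R) (hnu : invariant_acpm gamma nu).
Local Notation T := (Tmap gamma).
Local Notation psi0 := (psi0 gamma).
Local Notation F := (cdf01 nu).

Lemma bounded_integrable01 (g : R -> R) M : measurable_fun setT g ->
  (forall x, unitI x -> `|g x| <= M) -> nu.-integrable unitI (EFin \o g).
Proof.
move=> mg gM; apply: measurable_bounded_integrable.
- exact: measurable_itv.
- by apply: le_lt_trans (probability_le1 nu _) (ltry 1); exact: measurable_itv.
- exact: measurable_funTS.
- exists M; split; first exact: num_real.
  by move=> y My x /gM h; exact: le_trans h (ltW My).
Qed.

Lemma measurable_le_indic (g h : R -> R) : measurable_fun setT g -> measurable_fun setT h ->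
  measurable_fun setT (fun x => (g x <= h x)%R%:R : R).
Proof.
move=> mg mh.
have -> : (fun x => (g x <= h x)%R%:R : R) = (fun x => if g x <= h x then 1 else 0).
  by apply/funext => x; case: ifP.
by apply: measurable_fun_ifT => //; exact: measurable_fun_ler.
Qed.

Lemma RintegralD_sum (f : R -> R) (w : nat -> R) (g : nat -> R -> R) (r : seq nat) :
  nu.-integrable unitI (EFin \o f) -> (forall m, nu.-integrable unitI (EFin \o g m)) ->
  nu.-integrable unitI (EFin \o (fun x => f x + \sum_(m <- r) w m * g m x)) /\
  \int[nu]_(x in unitI) (f x + \sum_(m <- r) w m * g m x) =
  \int[nu]_(x in unitI) f x + \sum_(m <- r) w m * \int[nu]_(x in unitI) g m x.
Proof.
move=> intf intg; have mU : measurable (unitI : set (measurableTypeR R)) by exact: measurable_itv.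
elim: r => [|m r [IH1 IH2]].
  have -> : (fun x => f x + \sum_(m <- [::]) w m * g m x) = f.
    by apply/funext => x; rewrite big_nil addr0.
  by rewrite big_nil addr0.
have -> : (fun x => f x + \sum_(i <- m :: r) w i * g i x) =
   (fun x => w m * g m x + (f x + \sum_(i <- r) w i * g i x)).
  by apply/funext => x; rewrite big_cons addrCA.
have iw : nu.-integrable unitI (EFin \o (fun x => w m * g m x)).
  exact: (integrableZl mU (w m) (intg m)).
split; first exact: (integrableD mU iw IH1).
by rewrite RintegralD// RintegralZl// IH2 big_cons addrCA.
Qed.

Context (r : seq nat) (w z : nat -> R).
Context (w0 : forall m, 0 <= w m) (z01 : forall m, 0 <= z m <= 1).

(** The decreasing weight is encoded as a finite nonnegative combination of indicators [T x <= z m],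
    active only on the right branch. *)
Definition jump_weight x : R :=
  1 + (2^-1 < x)%R%:R * \sum_(m <- r) w m * (T x <= z m)%R%:R.

Definition orbit_weight k x : R := \prod_(0 <= i < k) jump_weight (iter i T x).

Lemma jump_weight_ge1 x : 1 <= jump_weight x.
Proof.
rewrite lerDl mulr_ge0//; apply: sumr_ge0 => m _; exact: mulr_ge0.
Qed.

Lemma jump_weight_le x : jump_weight x <= 1 + \sum_(m <- r) w m.
Proof.
rewrite lerD2l; apply: (@le_trans _ _ (\sum_(m <- r) w m * (T x <= z m)%R%:R)).
  by case: (2^-1 < x); rewrite ?mul1r// mul0r; apply: sumr_ge0 => m _; exact: mulr_ge0.
by apply: ler_sum => m _; case: (T x <= z m); rewrite ?mulr1// mulr0.
Qed.

Lemma orbit_weight_ge1 k x : 1 <= orbit_weight k x.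
Proof.
rewrite /orbit_weight; elim: k => [|k IH]; first by rewrite big_geq.
rewrite big_nat_recr//=; have := jump_weight_ge1 (iter k T x).
move=> h; apply: (le_trans IH); rewrite ler_peMr//; exact: le_trans ler01 IH.
Qed.

Lemma orbit_weight_bound k x : `|orbit_weight k x| <= (1 + \sum_(m <- r) w m) ^+ k.
Proof.
rewrite ger0_norm; last exact: le_trans (orbit_weight_ge1 k x).
rewrite /orbit_weight; elim: k => [|k IH]; first by rewrite big_geq.
rewrite big_nat_recr//= exprSr ler_pM//.
- exact: le_trans (orbit_weight_ge1 k x).
- exact: le_trans (jump_weight_ge1 _).
- exact: jump_weight_le.
Qed.

Lemma measurable_jump_weight : measurable_fun (setT : set (measurableTypeR R)) jump_weight.
Proof.
apply: measurable_funD => //; apply: measurable_funM.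
  have -> : (fun x : R => (2^-1 < x)%R%:R : R) = (fun x => if 2^-1 < x then 1 else 0).
    by apply/funext => x; case: ifP.
  by apply: measurable_fun_ifT => //; apply: measurable_fun_ltr.
apply: measurable_sum => m; apply: measurable_funM => //.
by apply: measurable_le_indic => //; exact: measurable_Tmap.
Qed.

Lemma measurable_orbit_weight k :
  measurable_fun (setT : set (measurableTypeR R)) (orbit_weight k).
Proof.
apply: measurable_prod => i _.
exact: (measurableT_comp measurable_jump_weight (measurable_iter_Tmap gamma i)).
Qed.

(** [wcdf k] is the distribution function of the image under the [k]-th iterate of the measure with
    density [orbit_weight k] with respect to [nu]. *)
Definition wcdf_fun k y x : R := orbit_weight k x * (iter k T x <= y)%R%:R.
Definition wcdf k y : R := \int[nu]_(x in unitI) wcdf_fun k y x.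

Lemma integrable_wcdf_fun k y : nu.-integrable unitI (EFin \o wcdf_fun k y).
Proof.
apply: (@bounded_integrable01 _ ((1 + \sum_(m <- r) w m) ^+ k)).
  apply: measurable_funM; first exact: measurable_orbit_weight.
  by apply: measurable_le_indic => //; exact: measurable_iter_Tmap.
move=> x _; rewrite /wcdf_fun; case: (_ <= y); rewrite ?mulr1 ?mulr0 ?orbit_weight_bound//.
by rewrite normr0 exprn_ge0// addr_ge0// sumr_ge0.
Qed.

Lemma wcdf_ge0 k y : 0 <= wcdf k y.
Proof.
apply: Rintegral_ge0 => x _; rewrite mulr_ge0//.
exact: le_trans (orbit_weight_ge1 k x).
Qed.

Lemma wcdf_nd k : nondecreasing01 (wcdf k).
Proof.
move=> x y x0 xy y1; apply: le_Rintegral; [exact: measurable_itv| | |];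
  try exact: integrable_wcdf_fun.
move=> t _; rewrite ler_wpM2l//; first exact: le_trans (orbit_weight_ge1 k t).
by case: (leP (iter k T t) x) => // h; rewrite (le_trans h xy).
Qed.

Lemma wcdf0E y : 0 <= y <= 1 -> wcdf 0 y = F y.
Proof.
move=> /andP[y0 y1]; rewrite /wcdf /cdf01 /Rintegral.
have -> : (`[0, y]%classic : set (measurableTypeR R)) = `[0, y]%classic `&` unitI.
  by apply/esym/setIidl; apply: subset_itvl; rewrite bnd_simp.
rewrite -integral_indic//; last exact: measurable_itv.
congr fine; apply: eq_integral => x; rewrite inE /unitI/= in_itv/= => hx.
rewrite /wcdf_fun /orbit_weight big_geq// mul1r indicE/= mem_setE in_itv/=.
by case/andP: hx => -> _.
Qed.

(** One step of the weighted transfer operator. Mass reaches [[0, y]] from [[0, psi0 y]] or from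
    []1/2, psi1 y]], and the coefficient [w m] counts once more what jumps below both [y] and
    [z m]. *)
Lemma wcdfS k y : 0 <= y <= 1 ->
  wcdf k.+1 y = wcdf k (psi0 y) + (wcdf k (psi1 y) - wcdf k 2^-1) +
    \sum_(m <- r) w m * (wcdf k (psi1 (Num.min y (z m))) - wcdf k 2^-1).
Proof.
move=> hy; have mU : measurable (unitI : set (measurableTypeR R)) by exact: measurable_itv.
have iB y1 y2 : nu.-integrable unitI (EFin \o (fun x => wcdf_fun k y1 x - wcdf_fun k y2 x)).
  exact: (integrableB mU (integrable_wcdf_fun k y1) (integrable_wcdf_fun k y2)).
have BE y1 y2 : wcdf k y1 - wcdf k y2 = \int[nu]_(x in unitI) (wcdf_fun k y1 x - wcdf_fun k y2 x).
  by rewrite RintegralB//; exact: integrable_wcdf_fun.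
rewrite BE; under eq_bigr do rewrite BE.
rewrite -RintegralD//; last exact: integrable_wcdf_fun.
have iD : nu.-integrable unitI (EFin \o (fun x =>
    wcdf_fun k (psi0 y) x + (wcdf_fun k (psi1 y) x - wcdf_fun k 2^-1 x))).
  exact: (integrableD mU (integrable_wcdf_fun k _) (iB _ _)).
have [_ <-] := @RintegralD_sum _ w
  (fun m x => wcdf_fun k (psi1 (Num.min y (z m))) x - wcdf_fun k 2^-1 x)
  r iD (fun m => iB _ _).
apply: eq_Rintegral => x; rewrite inE /unitI/= in_itv/= => hx.
rewrite /wcdf_fun /orbit_weight big_nat_recr//= -/(orbit_weight k x).
have := iter_Tmap_in hgamma k hx; set u := iter k T x => hu.
under eq_bigr do rewrite -mulrBr mulrCA.
rewrite -mulr_sumr -mulrBr -!mulrDr -mulrA; congr (_ * _).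
rewrite /jump_weight; case: (leP u 2^-1) => u2.
  rewrite mul0r addr0 mul1r (Tmap_le hgamma)//; last by lra.
  have psi1_ge t : 0 <= t -> u <= psi1 t by rewrite /psi1; lra.
  rewrite psi1_ge ?subrr ?addr0; last by case/andP: hy.
  rewrite big1 ?addr0// => m _; rewrite psi1_ge ?subrr ?mulr0//.
  by rewrite le_min; have := z01 m; lra.
have hp : (u <= psi0 y) = false.
  by apply/negbTE; rewrite -ltNge; have := psi0_in hgamma hy; lra.
have psi1E t : (T u <= t) = (u <= psi1 t).
  by rewrite Tmap_right// /psi1; apply/idP/idP; lra.
rewrite hp add0r subr0 mul1r mulrDl mul1r psi1E; congr (_ + _).
rewrite mulr_suml; apply: eq_bigr => m _; rewrite subr0 -mulrA -!psi1E le_min.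
by congr (_ * _); case: (T u <= y); case: (T u <= z m); rewrite ?mulr1 ?mulr0.
Qed.

(** Up to constants, each term of the recursion composes the nondecreasing concave [wcdf k] with a
    concave map: [psi0], [psi1], or [psi1] after truncation at [z m]. The coefficients [w m] are
    nonnegative. *)
Lemma wcdf_concave k : concave01 (wcdf k).
Proof.
elim: k => [|k IH] x y t hx hy ht; have hxy := conv01 hx hy ht.
  by rewrite !wcdf0E//; apply: (cdf01_concave hgamma hnu).
rewrite !wcdfS//; have nd := wcdf_nd k.
have := concave01_comp IH nd (psi0_concave hgamma) (psi0_in01 hgamma) hx hy ht.
have cg := concave01_comp IH nd psi1_concave psi1_in01.
have := cg _ _ _ hx hy ht.
have : t * (\sum_(m <- r) w m * (wcdf k (psi1 (Num.min x (z m))) - wcdf k 2^-1)) +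
  (1 - t) * (\sum_(m <- r) w m * (wcdf k (psi1 (Num.min y (z m))) - wcdf k 2^-1)) <=
  \sum_(m <- r) w m * (wcdf k (psi1 (Num.min (t * x + (1 - t) * y) (z m))) - wcdf k 2^-1).
  rewrite !mulr_sumr -big_split/=; apply: ler_sum => m _.
  have gnd : nondecreasing01 (wcdf k \o psi1).
    by move=> a b a0 ab b1; apply: nd; rewrite /psi1; lra.
  have minc : concave01 (fun u => Num.min u (z m)).
    move=> a b s ha hb hs; rewrite le_min; apply/andP; split.
      by apply: lerD; apply: ler_wpM2l; rewrite ?ge_min ?lexx//; lra.
    have -> : z m = s * z m + (1 - s) * z m by ring.
    by apply: lerD; apply: ler_wpM2l; rewrite ?ge_min ?lexx ?orbT//; lra.
  have min01 a : 0 <= a <= 1 -> 0 <= Num.min a (z m) <= 1.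
    by move=> ha; rewrite le_min ge_min; have := z01 m; case/andP: ha => -> -> /andP[-> _].
  have := ler_wpM2l (w0 m) (concave01_comp cg gnd minc min01 hx hy ht).
  by rewrite /=; set u := wcdf k (psi1 (Num.min (_ + _) _)); lra.
rewrite /=; set S1 := \sum_(m <- r) _; set S2 := \sum_(m <- r) _; set S3 := \sum_(m <- r) _.
lra.
Qed.

(** At [y = 1] the unweighted terms add up to [wcdf k 1], and concavity bounds the mass of []1/2,
    psi1 (z m)]] by [z m] times the total. *)
Lemma wcdf_total k : wcdf k 1 <= (1 + \sum_(m <- r) w m * z m) ^+ k.
Proof.
have h1 : 0 <= (1 : R) <= 1 by lra.
elim: k => [|k IH]; first by rewrite wcdf0E// (cdf01_1 hnu) expr0.
rewrite wcdfS// (psi0_1 hgamma) exprS.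
have -> : psi1 (1 : R) = 1 by rewrite /psi1; lra.
apply: (@le_trans _ _ ((1 + \sum_(m <- r) w m * z m) * wcdf k 1)); last first.
  rewrite ler_wpM2l// addr_ge0// sumr_ge0// => m _; rewrite mulr_ge0//.
  by case/andP: (z01 m).
rewrite addrCA subrr addr0 mulrDl mul1r lerD2l mulr_suml; apply: ler_sum => m _.
have /andP[z0 z1] := z01 m.
rewrite (min_idPr z1) -mulrA ler_wpM2l//.
by apply: concave01_half; [exact: wcdf_concave|exact: wcdf_nd|exact: wcdf_ge0|exact: z01].
Qed.

Lemma orbit_weight_integral n :
  \int[nu]_(x in unitI) orbit_weight n x <= (1 + \sum_(m <- r) w m * z m) ^+ n.
Proof.
apply: le_trans (wcdf_total n); rewrite le_eqVlt; apply/orP; left; apply/eqP.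
apply: eq_Rintegral => x; rewrite inE /unitI/= in_itv/= => hx.
by rewrite /wcdf_fun; have /andP[_ ->] := iter_Tmap_in hgamma n hx; rewrite mulr1.
Qed.

Lemma orbit_weight_markov n (B : set (measurableTypeR R)) a :
  measurable B -> B `<=` unitI -> 0 < a -> (forall x, B x -> a <= orbit_weight n x) ->
  (nu B <= ((1 + \sum_(m <- r) w m * z m) ^+ n / a)%:E)%E.
Proof.
move=> mB BU a0 hB.
have mU : measurable (unitI : set (measurableTypeR R)) by exact: measurable_itv.
have iE : nu.-integrable unitI (EFin \o orbit_weight n).
  apply: (@bounded_integrable01 _ ((1 + \sum_(m <- r) w m) ^+ n)).
    exact: measurable_orbit_weight.
  by move=> x _; exact: orbit_weight_bound.
rewrite -[nu B]fineK ?fin_num_measure// lee_fin ler_pdivlMr// mulrC.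
apply: le_trans (orbit_weight_integral n).
have <- : \int[nu]_(x in unitI) (a * \1_B x) = a * fine (nu B).
  rewrite RintegralZl//; last first.
    apply: (@bounded_integrable01 _ 1); first exact: measurable_indic.
    by move=> x _; rewrite indicE; case: (_ \in _); rewrite ?normr1 ?normr0.
  by rewrite /Rintegral integral_indic// setIidl.
apply: le_Rintegral => //.
  apply: (@bounded_integrable01 _ a); first by apply: measurable_funM => //; exact: measurable_indic.
  by move=> x _; rewrite indicE; case: (_ \in _); rewrite ?mulr1 ?mulr0 ?normr0 ?gtr0_norm// ltW.
move=> x _; rewrite indicE; case: (boolP (x \in B)) => [/set_mem/hB|_]; rewrite ?mulr1// mulr0 => //.
exact: le_trans (orbit_weight_ge1 n x).
Qed.

End exponential_weights.

(** * The square-root bound near [0] and the sequence of levels *)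

Section tail_of_cdf.
Context {R : realType} (gamma : R) (hgamma : 0 < gamma <= 1).
Context (nu : probability (measurableTypeR R) R) (hnu : invariant_acpm gamma nu).
Local Notation T := (Tmap gamma).
Local Notation psi0 := (psi0 gamma).
Local Notation F := (cdf01 nu).
Local Notation d := (dmin gamma).

(** Continuity at [0], from the local slope there; it closes the iteration towards [0] in
    [cdf01_le_sqrt]. *)
Lemma cdf01_small e : 0 < e ->
  exists2 y0, 0 < y0 & forall y, 0 <= y <= 1 -> y <= y0 -> F y <= e.
Proof.
move=> e0; have e2 : 0 < e / 2 by lra.
case: hnu => _ ac _; have [d' [K [a [d0 Knd K1 a0 hK]]]] := ac_local_slope ac e2.
have a1 : 0 < a 0 + 1 by have := a0 0; lra.
exists (Num.min d' (e / 2 / (a 0 + 1))); first by rewrite lt_min d0 divr_gt0.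
move=> y /andP[y0 y1]; rewrite le_min => /andP[yd]; rewrite ler_pdivlMr// => ya.
have := hK 0 y (lexx _) y0 y1; rewrite subr0 => /(_ yd).
rewrite (cdf01_0 hnu) subr0 ler_norml => /andP[_ h].
have := Knd _ _ (lexx _) y0 y1; have := Knd _ _ y0 y1 (lexx _).
have : a 0 * y = y * (a 0 + 1) - y by ring.
by lra.
Qed.

(** [incr] decays like a power of [|ln x|], hence more slowly than [sqrt x]. *)
Lemma incr_sqrt_bound : exists2 A : R, 0 < A &
  forall x, 0 < x <= 2^-1 -> 4 * Num.sqrt (2 * x) <= A * incr gamma x.
Proof.
have b1 : 0 < 1 + beta gamma by have := beta_ge0 hgamma; lra.
(* The constant of [powR_le_expR] for the base [1 + |ln x|]. The exponent [1 + beta gamma] is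
   positive even when [beta gamma = 0], and a base of at least [1] allows passing from [beta gamma]
   to it. *)
pose C := ((1 + beta gamma) / 2^-1) `^ (1 + beta gamma) * expR (2^-1).
have C0 : 0 < C by rewrite mulr_gt0 ?expR_gt0// powR_gt0// divr_gt0//; lra.
have s20 : 0 <= Num.sqrt (2 : R) by exact: sqrtr_ge0.
exists (4 * (1 + Num.sqrt 2) * C / cT gamma).
  by rewrite divr_gt0 ?cT_gt0// mulr_gt0//; lra.
move=> x hx; have /andP[x0 x2] := hx.
have l0 := lt_le_trans ln2_gt0 (ln2_le_abs_ln hx).
have p0 : 0 < `|ln x| `^ beta gamma by rewrite powR_gt0.
have -> : 4 * (1 + Num.sqrt 2) * C / cT gamma * incr gamma x =
          4 * (1 + Num.sqrt 2) * (C / `|ln x| `^ beta gamma).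
  by rewrite /incr; field; rewrite !gt_eqF ?cT_gt0.
rewrite sqrtrM//.
suff h : Num.sqrt x <= C / `|ln x| `^ beta gamma.
  have sx := sqrtr_ge0 x; have := ler_wpM2l s20 h; nra.
have -> : Num.sqrt x = expR (- (2^-1 * `|ln x|)).
  have {1}-> : x = expR (- (2^-1 * `|ln x|)) ^+ 2.
    rewrite -expRM_natl abs_ln; last by lra.
    have -> : 2%:R * - (2^-1 * - ln x) = ln x by field.
    by rewrite lnK// posrE.
  by rewrite sqrtr_sqr ger0_norm// expR_ge0.
rewrite ler_pdivlMr// expRN mulrC ler_pdivrMr ?expR_gt0//.
have h1 : 0 <= 1 + `|ln x| by lra.
have := @powR_le_expR R (1 + `|ln x|) (1 + beta gamma) 2^-1 h1 b1 ltac:(lra).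
rewrite mulrDr mulr1 expRD mulrA -/C; apply: le_trans.
apply: (@le_trans _ _ ((1 + `|ln x|) `^ beta gamma)).
  by rewrite ge0_ler_powR ?(beta_ge0 hgamma) ?nnegrE//; lra.
by rewrite ler_powR//; lra.
Qed.

(** [F - A sqrt] does not decrease when [y] is replaced by [psi0 y]: the drop of [F] is at most [y],
    while that of [A sqrt] is at least [y] by [incr_sqrt_bound]. Iterating [psi0] leads to points
    where [F] is arbitrarily small. *)
Lemma cdf01_le_sqrt : exists2 A : R, 0 < A & forall z, 0 <= z <= 1 -> F z <= A * Num.sqrt z.
Proof.
have [A A0 hA] := incr_sqrt_bound; exists A => // z hz.
have step y : 0 <= y <= 1 -> F y - A * Num.sqrt y <= F (psi0 y) - A * Num.sqrt (psi0 y).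
  move=> hy; have := cdf01_psi0 hgamma hnu hy; have /andP[y0 y1] := hy.
  suff : y <= A * (Num.sqrt y - Num.sqrt (psi0 y)) by lra.
  move: y0; rewrite le_eqVlt => /predU1P[<-|y0].
    by rewrite (psi0_0 hgamma) subrr mulr0.
  have hp : 0 < psi0 y <= 2^-1 by apply: (psi0_gt0 hgamma); rewrite y0.
  set p := psi0 y in hp *; have /andP[p0 p2] := hp.
  have yE : y = p * (1 + incr gamma p) by rewrite -Tmap_left// (Tmap_psi0 hgamma).
  have i0 := incr_gt0 gamma hp; have i1 := incr_le1 hgamma hp.
  have y2p : y <= 2 * p by rewrite yE; nra.
  have sy0 : 0 < Num.sqrt y by rewrite sqrtr_gt0.
  have spy : Num.sqrt p <= Num.sqrt y by apply: ler_wsqrtr; rewrite yE; nra.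
  have sy2 : Num.sqrt y <= Num.sqrt (2 * p) by exact: ler_wsqrtr.
  have sp0 := sqrtr_ge0 p.
  have h4 : 4 * Num.sqrt y <= A * incr gamma p by apply: le_trans (hA _ hp); lra.
  (* The difference [y - p = p * incr gamma p], factored as a difference of two squares. *)
  have dE : (Num.sqrt y - Num.sqrt p) * (Num.sqrt y + Num.sqrt p) = p * incr gamma p.
    by rewrite -subr_sqr !sqr_sqrtr; rewrite ?(ltW y0) ?(ltW p0)//; rewrite {1}yE; ring.
  rewrite -(ler_pM2r (_ : 0 < 2 * Num.sqrt y)); last by lra.
  apply: (@le_trans _ _ (A * ((Num.sqrt y - Num.sqrt p) * (Num.sqrt y + Num.sqrt p)))).
    rewrite dE; have := ler_wpM2l (ltW p0) h4; have := ler_wpM2r (ltW sy0) y2p; lra.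
  rewrite -mulrA ler_wpM2l ?(ltW A0)//; rewrite ler_wpM2l ?subr_ge0//; lra.
apply/ler_addgt0Pr => e e0; have [y0 y00 hy0] := cdf01_small e0.
have [N hN] := iter_psi0_small hgamma y00.
have : F z - A * Num.sqrt z <= F (iter N psi0 z) - A * Num.sqrt (iter N psi0 z).
  elim: N {hN} => [|N IH]//=; apply: (le_trans IH); apply: step.
  exact: (iter_psi0_in hgamma).
have := hy0 _ (iter_psi0_in hgamma N hz) (hN _ hz).
by have := mulr_ge0 (ltW A0) (sqrtr_ge0 (iter N psi0 z)); lra.
Qed.

(** The point of depth [m d]. With spacing [d] a step of the left branch climbs at least one
    level. *)
Definition level (m : nat) : R := expR (- (m%:R * d) `^ gamma).

Lemma level_gt0 m : 0 < level m. Proof. exact: expR_gt0. Qed.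

Lemma level_le1 m : level m <= 1.
Proof. by rewrite /level expR_le1 oppr_le0 powR_ge0. Qed.

Lemma level01 m : 0 <= level m <= 1.
Proof. by rewrite level_le1 ltW ?level_gt0. Qed.

Lemma md_ge0 (m : nat) : 0 <= m%:R * d.
Proof. by rewrite mulr_ge0// ltW// dmin_gt0. Qed.

Lemma le_level x m : 0 < x <= 1 -> (x <= level m) = (m%:R * d <= depth gamma x).
Proof. by move=> hx; rewrite (le_depth hgamma hx (md_ge0 m)). Qed.

Lemma level_anti m n : (m <= n)%N -> level n <= level m.
Proof.
move=> mn; rewrite ler_expR lerN2 ge0_ler_powR ?nnegrE ?md_ge0//.
  by rewrite ltW// gamma_gt0.
by rewrite ler_wpM2r ?ler_nat// ltW// dmin_gt0.
Qed.

Lemma level_Tmap x m : 0 < x <= 2^-1 -> level m.+1 < x -> level m < T x.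
Proof.
move=> hx; rewrite !ltNge; apply: contraNN.
have hx1 : 0 < x <= 1 by lra.
rewrite le_level ?(Tmap_in_pos hgamma)// le_level//.
by have := depth_Tmap_le hgamma hx; rewrite -natr1 mulrDl; lra.
Qed.

(** Read from right to left: the weight [e^(c m)] of [large_deviation], with [c m] half of the
    exponent, leaves a square root of [level m]. *)
Lemma sqrt_level m : Num.sqrt (level m) = expR ((m%:R * d) `^ gamma / 2) * level m.
Proof.
rewrite /level -expRD; set c := _ `^ _.
have -> : expR (- c) = expR (c / 2 + - c) ^+ 2.
  by rewrite -expRM_natl; congr expR; field.
by rewrite sqrtr_sqr ger0_norm// expR_ge0.
Qed.

(** The square root decays faster than [m^-(q + 2)], so the terms are dominated by those of a
    telescoping series. *)
Lemma level_series q e : 0 < e -> exists2 M0 : nat, (0 < M0)%N &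
  forall m0 M, (M0 <= m0)%N ->
    \sum_(m0 <= m < M) m%:R ^+ q * Num.sqrt (level m) <= e.
Proof.
move=> e0; have d0 : 0 < d := @dmin_gt0 R gamma; have g0 := gamma_gt0 hgamma.
(* Chosen so that [((m d)^gamma)^a = (m d)^(q + 2)]. *)
pose a : R := q.+2%:R / gamma; have a0 : 0 < a by rewrite divr_gt0.
pose K := 2 * ((a / 2^-1) `^ a / d ^+ q.+2).
have K0 : 0 < K by rewrite mulr_gt0// divr_gt0 ?exprn_gt0// powR_gt0// divr_gt0.
have term m : (0 < m)%N -> m%:R ^+ q * Num.sqrt (level m) <= K * (m%:R^-1 - m.+1%:R^-1).
  move=> m0; have m0' : 0 < m%:R :> R by rewrite ltr0n.
  have m1 : 1 <= m%:R :> R by rewrite ler1n.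
  have := @powR_le_expR R ((m%:R * d) `^ gamma) a 2^-1 (powR_ge0 _ _) a0 ltac:(lra).
  have -> : ((m%:R * d) `^ gamma) `^ a = m%:R ^+ q.+2 * d ^+ q.+2.
    have ga : gamma * a = q.+2%:R by rewrite /a; field; rewrite gt_eqF.
    by rewrite -powRrM ga (powR_mulrn _ (md_ge0 m)) exprMn.
  move=> h; have -> : Num.sqrt (level m) = (expR (2^-1 * (m%:R * d) `^ gamma))^-1.
    by rewrite sqrt_level /level -expRD -expRN; congr expR; field.
  set E := expR _ in h *; have E0 : 0 < E by exact: expR_gt0.
  rewrite ler_pdivrMr// -natr1.
  have -> : K * (m%:R^-1 - (m%:R + 1)^-1) * E =
     (2 / (m%:R * (m%:R + 1))) * ((a / 2^-1) `^ a * E / d ^+ q.+2).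
    by rewrite /K; field; rewrite !gt_eqF ?exprn_gt0//; lra.
  apply: (@le_trans _ _ (2 / (m%:R * (m%:R + 1)) * m%:R ^+ q.+2)); last first.
    apply: ler_wpM2l; last by rewrite ler_pdivlMr// exprn_gt0.
    by rewrite divr_ge0// mulr_ge0//; lra.
  have -> : 2 / (m%:R * (m%:R + 1)) * m%:R ^+ q.+2 = (2 * m%:R / (m%:R + 1)) * m%:R ^+ q :> R.
    by rewrite !exprS; field; rewrite !gt_eqF//; lra.
  rewrite ler_peMl ?exprn_ge0 ?(ltW m0')// ler_pdivlMr; lra.
(* The telescoped sum is at most [K / m0]. *)
exists (Num.truncn (K / e)).+1 => // m0 M hm0.
have m00 : (0 < m0)%N by apply: leq_trans hm0.
have Ke : K / e < m0%:R.
  by apply: lt_le_trans (truncnS_gt _) _; rewrite ler_nat.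
have [Mm0|mM] := leqP M m0; first by rewrite big_geq// ltW.
have m00' : 0 < m0%:R :> R by rewrite ltr0n.
apply: (@le_trans _ _ (\sum_(m0 <= m < M) K * (m%:R^-1 - m.+1%:R^-1))).
  rewrite big_nat_cond [leRHS]big_nat_cond; apply: ler_sum => m /andP[/andP[m0m _] _].
  by apply: term; exact: leq_trans m0m.
rewrite (@telescope_sumr_eq _ _ _ (fun m => - (K * m%:R^-1))) ?(ltnW mM)//; last first.
  by move=> k _; ring.
rewrite opprK addrC; apply: (@le_trans _ _ (K * m0%:R^-1)).
  by rewrite gerBl mulr_ge0 ?invr_ge0// ltW.
by rewrite ler_pdivrMr//; move: Ke; rewrite ltr_pdivrMr// mulrC => /ltW.
Qed.

End tail_of_cdf.

(** [N] will be the cut-off level: a single excursion above it in the sense of depth contributes at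
    most [N^(q + 1) <= n / 4]. *)
Lemma nat_root_floor (q n : nat) :
  exists N : nat, (4 * N ^ q.+1 <= n < 4 * N.+1 ^ q.+1)%N.
Proof.
elim: n => [|n [N /andP[h1 h2]]]; first by exists 0; rewrite exp0n// muln0 exp1n.
have [h|h] := ltnP n.+1 (4 * N.+1 ^ q.+1); first by exists N; rewrite (leqW h1).
exists N.+1; by rewrite h (leq_ltn_trans h2)//= ltn_pmul2l// ltn_exp2r.
Qed.

(** * Charging excursions near [0] to the jumps that start them *)

Section excursion_potential.
Context {R : realType} (gamma : R) (hgamma : 0 < gamma <= 1).
Local Notation T := (Tmap gamma).
Context (lev : nat -> R)
  (lev_anti : forall m n, (m <= n)%N -> lev n <= lev m)
  (lev_Tmap : forall x m, 0 < x <= 2^-1 -> lev m.+1 < x -> lev m < T x).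
Context (q m0 : nat) (m0_gt0 : (0 < m0)%N) (lev_m0 : lev m0 <= 2^-1).

(* Dominates the sum of [phi] over an excursion near [0] started at [x], cut
   off at depth [N]. *)
Definition potential N (x : R) : R :=
  \sum_(m0 <= m < N.+1) m%:R ^+ q * (x <= lev m)%R%:R.

Lemma potential_ge0 N x : 0 <= potential N x.
Proof. by apply: sumr_ge0 => m _; rewrite mulr_ge0// exprn_ge0. Qed.

(** Each of the [M - m0 + 1] terms is at most [M^q], and [m0 > 0] makes their number at most [M]. *)
Lemma sum_powers_le M (x : R) : (m0 <= M)%N ->
  \sum_(m0 <= m < M) m%:R ^+ q * (x <= lev m)%R%:R + M%:R ^+ q <= M%:R ^+ q.+1 :> R.
Proof.
move=> m0M; apply: (@le_trans _ _ (\sum_(m0 <= m < M) (M%:R : R) ^+ q + M%:R ^+ q)).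
  rewrite lerD2r big_nat_cond [leRHS]big_nat_cond; apply: ler_sum => m /andP[/andP[_ mM] _].
  apply: (@le_trans _ _ (m%:R ^+ q)); first by case: (x <= _); rewrite ?mulr1// mulr0 exprn_ge0.
  by rewrite lerXn2r ?nnegrE// ler_nat ltnW.
rewrite big_const_nat iter_addr_0 -mulrSr -[_ *+ _.+1]mulr_natl exprS.
by rewrite ler_wpM2r ?exprn_ge0// ler_nat ltn_subrL m0_gt0 (leq_trans m0_gt0 m0M).
Qed.

Lemma potential_le N x : potential N x <= N%:R ^+ q.+1.
Proof.
rewrite /potential; have [Nm|mN] := ltnP N m0.
  by rewrite big_geq// exprn_ge0.
rewrite big_nat_recr//=; apply: le_trans (sum_powers_le x mN); rewrite lerD2l.
by case: (x <= _); rewrite ?mulr1// mulr0 exprn_ge0.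
Qed.

(** Brings the exponential into the form required by [jump_weight]. Passing level [M] raises the
    exponent by [b = lam M^q] to some [u <= c M], and [e^u - e^(u - b) <= b e^u]. *)
Lemma expR_potential_le N (lam : R) (c : nat -> R) x : 0 <= lam ->
  (forall m, (m <= N)%N -> lam * m%:R ^+ q.+1 <= c m) ->
  expR (lam * potential N x) <=
    1 + \sum_(m0 <= m < N.+1) (lam * m%:R ^+ q * expR (c m)) * (x <= lev m)%R%:R.
Proof.
move=> lam0 hc; rewrite /potential.
have : forall m, (m < N.+1)%N -> lam * m%:R ^+ q.+1 <= c m by move=> m /hc.
elim: N.+1 => [|M IH] {}hc; first by rewrite !big_geq// mulr0 expR0 addr0.
have [Mm|mM] := ltnP M m0; first by rewrite !big_geq// mulr0 expR0 addr0.
have {}IH := IH (fun m mM => hc m (ltnW mM)).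
rewrite !big_nat_recr//=; case: (x <= lev M); last by rewrite !mulr0 !addr0.
rewrite !mulr1 addrA; move: IH; set V := \sum_(_ <= _ < _) _; set W := \sum_(_ <= _ < _) _ => IH.
have hV : V + M%:R ^+ q <= M%:R ^+ q.+1 by exact: sum_powers_le.
set b := lam * M%:R ^+ q; have b0 : 0 <= b by rewrite mulr_ge0// exprn_ge0.
have cE : expR (lam * (V + M%:R ^+ q)) <= expR (c M).
  by rewrite ler_expR; apply: le_trans (hc M (leqnn _)); rewrite ler_wpM2l.
have : expR (lam * (V + M%:R ^+ q)) * (1 - b) <= expR (lam * V).
  have -> : lam * V = lam * (V + M%:R ^+ q) + - b by rewrite /b; ring.
  by rewrite expRD ler_wpM2l ?expR_ge0// expR_ge1Dx.
have := ler_wpM2l b0 cE; lra.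
Qed.

Lemma find_level N x : lev N.+1 < x -> x <= lev m0 ->
  exists m, (m0 <= m <= N)%N /\ lev m.+1 < x <= lev m.
Proof.
elim: N => [|N IH] hN hx.
  by have := lev_anti m0_gt0; rewrite leNgt (lt_le_trans hN hx).
have [h|h] := leP x (lev N.+1).
  have m0N : (m0 <= N.+1)%N.
    rewrite leqNgt; apply/negP => m0N; have := lev_anti m0N.
    by rewrite leNgt (lt_le_trans hN hx).
  by exists N.+1; rewrite m0N leqnn hN h.
by have [m [/andP[m1 m2] m3]] := IH h hx; exists m; rewrite m1 leqW.
Qed.

Context (phi : R -> R).
Context (phi_out : forall x, lev m0 < x -> x <= 1 -> phi x <= 0).
Context (phi_in : forall x m, (m0 <= m)%N -> lev m.+1 < x -> x <= lev m ->
  phi x <= m%:R ^+ q).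

(** On the left branch a point between levels [m + 1] and [m] climbs above level [m], which removes
    from the potential the term [m^q >= phi x]. On the right branch [phi x <= 0] and the new
    potential is charged to the jump. *)
Lemma potential_descent N x : 0 < x <= 1 -> lev N.+1 < x ->
  phi x + potential N (T x) <=
  potential N x + (2^-1 < x)%R%:R * potential N (T x).
Proof.
move=> hx hN; have /andP[x0 x1] := hx; case: (ltP 2^-1 x) => x2.
  have := potential_ge0 N x; have := phi_out (le_lt_trans lev_m0 x2) x1.
  by rewrite mul1r; lra.
rewrite mul0r addr0; have hx2 : 0 < x <= 2^-1 by rewrite x0.
have xT : x <= T x.
  by have /andP[] : x <= T x <= 2 * x by apply: (Tmap_left_bounds hgamma); lra.
have mono m : m%:R ^+ q * (T x <= lev m)%R%:R <= m%:R ^+ q * (x <= lev m)%R%:R :> R.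
  rewrite ler_wpM2l ?exprn_ge0//.
  by case: (leP (T x)) => // h; rewrite (le_trans xT h).
case: (ltP (lev m0) x) => hm0.
  have : potential N (T x) <= potential N x by apply: ler_sum => m _.
  by have := phi_out hm0 x1; lra.
have [m [/andP[m0m mN] /andP[xm1 xm]]] := find_level hN hm0.
have := phi_in m0m xm1 xm.
suff : m%:R ^+ q + potential N (T x) <= potential N x by lra.
rewrite /potential (bigD1_seq m) ?mem_index_iota ?m0m ?iota_uniq//=.
rewrite [leRHS](bigD1_seq m) ?mem_index_iota ?m0m ?iota_uniq//=.
have := lev_Tmap hx2 xm1; rewrite ltNge => /negbTE ->.
by rewrite xm mulr0 mulr1 add0r lerD2l; apply: ler_sum => i _.
Qed.

Lemma birkhoff_potential n N x : 0 < x <= 1 ->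
  (forall k, (k < n)%N -> lev N.+1 < iter k T x) ->
  \sum_(0 <= k < n) phi (iter k T x) + potential N (iter n T x) <= potential N x +
  \sum_(0 <= k < n) (2^-1 < iter k T x)%R%:R * potential N (iter k.+1 T x).
Proof.
move=> hx; elim: n => [|n IH] hn; first by rewrite !big_geq//= add0r addr0.
rewrite !big_nat_recr//=.
have := IH (fun k kn => hn k (ltnW kn)).
have := potential_descent (iter_Tmap_in_pos hgamma n hx) (hn n (ltnSn _)).
lra.
Qed.

(** Only the excursion in progress at time [0] is not paid for by a jump; it contributes at most
    [N^(q + 1)]. *)
Lemma expR_birkhoff_le n N (lam : R) (c : nat -> R) x : 0 <= lam ->
  (forall m, (m <= N)%N -> lam * m%:R ^+ q.+1 <= c m) -> 0 < x <= 1 ->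
  (forall k, (k < n)%N -> lev N.+1 < iter k T x) ->
  expR (lam * (\sum_(0 <= k < n) phi (iter k T x) - N%:R ^+ q.+1)) <=
  orbit_weight gamma (index_iota m0 N.+1) (fun m => lam * m%:R ^+ q * expR (c m)) lev n x.
Proof.
move=> lam0 hc hx hn.
apply: (@le_trans _ _ (expR (lam * \sum_(0 <= k < n)
    (2^-1 < iter k T x)%R%:R * potential N (iter k.+1 T x)))).
  rewrite ler_expR ler_wpM2l//.
  have := birkhoff_potential hx hn; have := potential_ge0 N (iter n T x).
  have := potential_le N x; lra.
rewrite mulr_sumr expR_sum; apply: ler_prod => k _; rewrite expR_ge0/= /jump_weight.
case: (2^-1 < _); rewrite ?mul1r ?mul0r ?mulr0 ?expR0 ?addr0//.
exact: expR_potential_le.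
Qed.

End excursion_potential.

(** * The upper large deviation bound *)

Section large_deviations.
Context {R : realType} (gamma : R) (hgamma : 0 < gamma <= 1).
Context (nu : probability (measurableTypeR R) R) (hnu : invariant_acpm gamma nu).
Local Notation T := (Tmap gamma).
Local Notation F := (cdf01 nu).
Local Notation d := (dmin gamma).
Local Notation level := (level gamma).

Definition visits (n : nat) (y : R) : set (measurableTypeR R) :=
  [set x | unitI x /\ exists2 k, (k < n)%N & iter k T x <= y].

Lemma visits_measure n y : 0 <= y <= 1 ->
  measurable (visits n y) /\ (nu (visits n y) <= (n%:R * F y)%:E)%E.
Proof.
move=> hy; elim: n => [|n [mV IH]].
  have -> : visits 0 y = set0 by apply/seteqP; split => x //= -[_ []].
  by rewrite measure0 mul0r.
have mA : measurable (`[0, y]%classic : set (measurableTypeR R)) by exact: measurable_itv.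
pose A : set (measurableTypeR R) := unitI `&` iter n T @^-1` `[0, y].
have mA' : measurable A.
  apply: measurableI; first exact: measurable_itv.
  by have := measurable_iter_Tmap gamma n measurableT mA; rewrite setTI.
have -> : visits n.+1 y = visits n y `|` A.
  apply/seteqP; split => x /=.
    move=> [Ux [k]]; rewrite ltnS leq_eqVlt => /predU1P[->|kn] hk; last first.
      by left; split => //; exists k.
    right; split => //=; rewrite in_itv/= hk andbT.
    by move: Ux; rewrite /unitI/= in_itv/= => /(iter_Tmap_in hgamma n)/andP[].
  move=> [[Ux [k kn hk]]|[Ux]]; first by split => //; exists k => //; exact: ltnW.
  by rewrite /= in_itv/= => /andP[_ h]; split => //; exists n.
have yU : `[0, y]%classic `<=` unitI.
  by apply: subset_itvl; rewrite bnd_simp; case/andP: hy.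
have eA : nu A = (F y)%:E by rewrite EFin_cdf01 -(iter_invariant hgamma hnu n mA yU).
split; first exact: measurableU.
apply: le_trans (measureU2 _ mV mA') _.
rewrite -natr1 mulrDl mul1r EFinD; apply: leeD => //.
by rewrite -eA.
Qed.

(** Orbits reaching level [N + 1] are discarded. On the others the jumps must account for at least
    [n / 4] of the sum, and Markov's inequality yields [(1 + S)^n / e^(lam n / 4)]. The bound [1/8]
    in the hypothesis makes [S <= lam / 8]. *)
Lemma large_deviation (q m0 : nat) : (0 < m0)%N -> level m0 <= 2^-1 ->
  (forall M, \sum_(m0 <= m < M) m%:R ^+ q * Num.sqrt (level m) <= 8^-1) ->
  exists C kappa : R, [/\ 0 < C, 0 < kappa & forall phi : R -> R,
    (forall x, level m0 < x -> x <= 1 -> phi x <= 0) ->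
    (forall x m, (m0 <= m)%N -> level m.+1 < x -> x <= level m -> phi x <= m%:R ^+ q) ->
    forall (n : nat) (B : set (measurableTypeR R)), (0 < n)%N -> measurable B ->
      (forall x, B x -> 0 < x <= 1 /\ n%:R / 2 <= \sum_(0 <= k < n) phi (iter k T x)) ->
    (nu B <= (C * expR (- kappa * n%:R `^ (gamma / q.+1%:R)))%:E)%E].
Proof.
move=> m00 lm0 hsum; have g0 := gamma_gt0 hgamma; have d0 : 0 < d := @dmin_gt0 R gamma.
have [A A0 hA] := cdf01_le_sqrt hgamma hnu.
set th := gamma / q.+1%:R; have th0 : 0 < th by rewrite divr_gt0.
have th1 : th <= 1.
  rewrite ler_pdivrMr// mul1r; case/andP: hgamma => _ /le_trans; apply.
  by rewrite ler1n.
have D0 : 0 < d `^ gamma by rewrite powR_gt0.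
pose b := d `^ gamma * 4^-1 `^ th / 2.
have b0 : 0 < b by rewrite !mulr_gt0// powR_gt0//; lra.
pose K := (th^-1 / (b / 2)) `^ th^-1.
have K0 : 0 <= K by exact: powR_ge0.
(* The first rate comes from Markov's inequality, the second from the discarded orbits. *)
pose kappa := Num.min (d `^ gamma / 16) (b / 2).
have kappa0 : 0 < kappa by rewrite lt_min; apply/andP; split; lra.
exists (1 + A * K), kappa; split => //; first by rewrite ltr_pwDl// mulr_ge0// ltW.
move=> phi phi_out phi_in n B n0 mB hB.
have n0' : 0 < n%:R :> R by rewrite ltr0n.
set X := n%:R `^ th; have X0 : 0 <= X by exact: powR_ge0.
have [N /andP[N1 N2]] := nat_root_floor q n.
have powth m : (m%:R ^+ q.+1) `^ th = m%:R `^ gamma :> R.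
  by rewrite -powR_mulrn// -powRrM; congr (_ `^ _); rewrite /th; field; rewrite addrC natr1 pnatr_eq0.
(* Half of the exponent of [level m], so that [e^(c m) * level m] is still summable. *)
pose c m : R := (m%:R * d) `^ gamma / 2.
have cE m : c m = d `^ gamma / 2 * m%:R `^ gamma by rewrite /c (powRM _ (ler0n R m) (ltW d0)); ring.
(* Makes [lam m^(q + 1) <= c m] for all [m <= N]: with [M = m^(q + 1) <= n] it reduces to
   [M / n <= (M / n)^th], which holds as [th <= 1]. *)
pose lam := d `^ gamma / 2 * (X / n%:R).
have lam0 : 0 <= lam by rewrite mulr_ge0 ?divr_ge0//; lra.
have N1' : N%:R ^+ q.+1 <= n%:R / 4 :> R.
  by rewrite ler_pdivlMr// mulrC -natrX -natrM ler_nat.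
have hc m : (m <= N)%N -> lam * m%:R ^+ q.+1 <= c m.
  move=> mN; rewrite cE /lam -mulrA ler_wpM2l//; first by lra.
  have [->|m_gt0] := posnP m; first by rewrite exprS mul0r mulr0 powR_ge0.
  have m0' : 0 < m%:R ^+ q.+1 :> R by rewrite exprn_gt0// ltr0n.
  rewrite -powth; set M := _ ^+ _ in m0' *.
  have hMn : 0 < M / n%:R <= 1.
    rewrite divr_gt0//= ler_pdivrMr// mul1r.
    apply: (@le_trans _ _ (N%:R ^+ q.+1)); last by lra.
    by rewrite lerXn2r ?nnegrE// ler_nat.
  have := ger1_powR hMn th1.
  have nV : (n%:R^-1) `^ th = X^-1.
    by rewrite -(powR_inv1 (ltW n0')) -powRrM mulN1r powRN.
  rewrite powRM ?invr_ge0 ?(ltW m0')// nV.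
  have X0' : 0 < X by rewrite powR_gt0.
  move=> /(ler_wpM2l X0).
  have -> : X * (M `^ th / X) = M `^ th by field; rewrite gt_eqF.
  by rewrite mulrCA mulrC mulrAC.
pose Y := visits n (level N.+1).
have [mY nuY] := visits_measure n (level01 gamma N.+1).
have hBY x : (B `\` Y) x -> expR (lam * (n%:R / 4)) <=
   orbit_weight gamma (index_iota m0 N.+1) (fun m => lam * m%:R ^+ q * expR (c m)) level n x.
  move=> [/hB[hx hs] nYx].
  apply: le_trans (expR_birkhoff_le hgamma (@level_anti _ _ hgamma)
    (@level_Tmap _ _ hgamma) m00 lm0 phi_out phi_in lam0 hc hx _).
    by rewrite ler_expR ler_wpM2l//; lra.
  move=> k kn; rewrite ltNge; apply/negP => hk; apply: nYx; split; last by exists k.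
  by rewrite /unitI/= in_itv/=; lra.
have w0 m : 0 <= lam * m%:R ^+ q * expR (c m).
  by rewrite mulr_ge0 ?expR_ge0// mulr_ge0.
have BYU : B `\` Y `<=` unitI.
  by move=> x [/hB[hx _] _]; rewrite /unitI/= in_itv/=; lra.
have := orbit_weight_markov hgamma hnu w0 (level01 gamma) (measurableD mB mY) BYU
  (expR_gt0 (lam * (n%:R / 4))) hBY.
set S := \sum_(_ <- _) _ => hS.
have S8 : S <= lam / 8.
  rewrite /S (eq_bigr (fun m => lam * (m%:R ^+ q * Num.sqrt (level m)))).
    by rewrite -mulr_sumr ler_wpM2l.
  by move=> m _; rewrite sqrt_level -/(c m); ring.
have S0 : 0 <= S.
  by apply: sumr_ge0 => m _; rewrite mulr_ge0 ?w0//; case/andP: (level01 gamma m).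
(* The exponent is at most [n S - lam n / 4 <= - lam n / 8], and [lam n = d^gamma X / 2]. *)
have h1 : (1 + S) ^+ n / expR (lam * (n%:R / 4)) <= expR (- kappa * X).
  rewrite ler_pdivrMr ?expR_gt0// -expRD.
  apply: (@le_trans _ _ (expR (n%:R * S))).
    rewrite expRM_natl lerXn2r ?nnegrE ?expR_ge0 ?expR_ge1Dx//; lra.
  rewrite ler_expR.
  have lamn : lam * n%:R = d `^ gamma / 2 * X by rewrite /lam; field; rewrite gt_eqF.
  have := ler_wpM2l (ltW n0') S8.
  have : kappa * X <= d `^ gamma / 16 * X by rewrite ler_wpM2r// ge_min lexx.
  lra.
(* The maximality of [N] gives [sqrt (level N.+1) <= e^(- b X)]; half of this decay absorbs the
   factor [n = X^(1 / th)]. *)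
have h2 : n%:R * F (level N.+1) <= A * K * expR (- kappa * X).
  have := hA _ (level01 gamma N.+1) => hF.
  have sE : Num.sqrt (level N.+1) <= expR (- (b * X)).
    rewrite sqrt_level -/(c N.+1) /level -expRD ler_expR.
    have -> : c N.+1 + - (N.+1%:R * d) `^ gamma = - c N.+1 by rewrite /c; field.
    rewrite lerN2 cE -powth.
    have : (n%:R / 4) `^ th <= (N.+1%:R ^+ q.+1) `^ th :> R.
      have n4 : 0 <= n%:R / 4 :> R by rewrite divr_ge0.
      rewrite ge0_ler_powR ?nnegrE ?(ltW th0)//.
      by rewrite ler_pdivrMr// mulrC -natrX -natrM ler_nat ltnW.
    rewrite powRM ?(ltW n0')//.
    rewrite -/X /b => h; have := ler_wpM2l (ltW D0) h; lra.
  have nE : n%:R <= K * expR (b / 2 * X).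
    have thi : 0 < th^-1 by rewrite invr_gt0.
    have b2 : 0 < b / 2 by lra.
    have := powR_le_expR X0 thi b2.
    by rewrite {1}/X -powRrM divff ?gt_eqF// powRr1// ltW.
  apply: (@le_trans _ _ (K * expR (b / 2 * X) * (A * expR (- (b * X))))).
    apply: ler_pM => //; first exact: fine_ge0.
    by apply: le_trans hF _; rewrite ler_wpM2l// ltW.
  have -> : K * expR (b / 2 * X) * (A * expR (- (b * X))) = A * K * expR (- (b / 2 * X)).
    have -> : - (b / 2 * X) = b / 2 * X + - (b * X) by field.
    by rewrite expRD; ring.
  rewrite ler_wpM2l ?mulr_ge0 ?(ltW A0)// ler_expR mulNr lerN2 ler_wpM2r// ge_min lexx orbT//.
have Bsub : B `<=` Y `|` (B `\` Y).
  by move=> x Bx; case: (pselect (Y x)) => h; [left|right].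
apply: (@le_trans _ _ (nu (Y `|` (B `\` Y)))).
  by apply: le_measure; rewrite ?inE//; apply: measurableU => //; exact: measurableD.
apply: le_trans (measureU2 _ mY (measurableD mB mY)) _.
apply: (@le_trans _ _ ((n%:R * F (level N.+1))%:E + ((1 + S) ^+ n / expR (lam * (n%:R / 4)))%:E)%E).
  exact: leeD.
rewrite -EFinD lee_fin; lra.
Qed.

End large_deviations.

Lemma powRD_le {R : realType} (a b g : R) : 0 <= a -> 0 <= b -> 0 <= g ->
  (a + b) `^ g <= (2 * a) `^ g + (2 * b) `^ g.
Proof.
move=> a0 b0 g0; have [ab|ba] := leP a b.
  apply: (@le_trans _ _ ((2 * b) `^ g)); last by rewrite lerDr powR_ge0.
  by rewrite ge0_ler_powR ?nnegrE//; lra.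
apply: (@le_trans _ _ ((2 * a) `^ g)); last by rewrite lerDl powR_ge0.
by rewrite ge0_ler_powR ?nnegrE//; lra.
Qed.

(** * Lower bounds from deep points, and the Lipschitz observable *)

Section deviations.
Context {R : realType} (gamma : R) (hgamma : 0 < gamma <= 1).
Context (nu : probability (measurableTypeR R) R) (hnu : invariant_acpm gamma nu).
Local Notation T := (Tmap gamma).
Local Notation F := (cdf01 nu).
Local Notation d := (dmin gamma).
Local Notation depth := (depth gamma).
Local Notation level := (level gamma).
Local Notation mU := (measurable_itv _ : measurable (unitI : set (measurableTypeR R))).

Lemma le_nu (A B : set (measurableTypeR R)) : measurable A -> measurable B -> A `<=` B ->
  (nu A <= nu B)%E.
Proof. by move=> mA mB AB; apply: le_measure => //; rewrite inE. Qed.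

(** The point [0] has no mass. It is set aside because [depth 0] is the default value [0], contrary
    to the behaviour nearby. *)
Lemma le_nu_pos (A : set (measurableTypeR R)) : measurable A -> A `<=` unitI ->
  (nu A <= nu (A `&` `]0%R, 1%R]))%E.
Proof.
move=> mA AU; have m0 : measurable (`[0%R, 0%R]%classic : set (measurableTypeR R)) by exact: measurable_itv.
have m1 : measurable (A `&` `]0%R, 1%R] : set (measurableTypeR R)).
  by apply: measurableI => //; exact: measurable_itv.
have z : nu `[0%R, 0%R]%classic = 0%E by rewrite -EFin_cdf01 (cdf01_0 hnu).
apply: (@le_trans _ _ (nu ((A `&` `]0%R, 1%R]) `|` `[0%R, 0%R]))).
  apply: le_nu => //; first exact: measurableU.
  move=> x Ax; have := AU x Ax; rewrite /unitI/= !in_itv/= => /andP[x0 x1].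
  move: x0; rewrite le_eqVlt => /predU1P[<-|x0]; first by right => /=; lra.
  by left; split => //; rewrite x0.
have h : (nu ((A `&` `]0%R, 1%R]) `|` `[0%R, 0%R]) <=
    nu (A `&` `]0%R, 1%R]) + nu `[0%R, 0%R]%classic)%E by exact: measureU2.
by rewrite z adde0 in h.
Qed.

(** Source of all lower bounds: the points of depth at least [a] fill []0, z]] with
    [z = e^(- a^gamma)], and [z <= F z]. *)
Lemma expR_le_nu_deep (B : set (measurableTypeR R)) a : measurable B -> 0 <= a ->
  (forall x, 0 < x <= 1 -> a <= depth x -> B x) ->
  ((expR (- a `^ gamma))%:E <= nu B)%E.
Proof.
move=> mB a0 hB; have z0 := expR_gt0 (- a `^ gamma).
have z1 : expR (- a `^ gamma) <= 1 by rewrite expR_le1 oppr_le0 powR_ge0.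
set z := expR _ in z0 z1 *.
have zI : 0 <= z <= 1 by rewrite z1 ltW.
apply: (@le_trans _ _ (nu `]0, z]%classic)).
  rewrite (cdf01_itv nu (lexx 0) (ltW z0)) (cdf01_0 hnu) subr0 lee_fin.
  exact: (le_cdf01 hgamma hnu).
apply: le_nu => //.
move=> x; rewrite /= in_itv/= => /andP[x0 xz].
have hx : 0 < x <= 1 by rewrite x0 (le_trans xz).
by apply: hB => //; rewrite (le_depth hgamma).
Qed.

Lemma measurable_abs_gt (g : R -> R) t :
  measurable_fun (setT : set (measurableTypeR R)) g -> measurable (abs_gt g t).
Proof.
move=> mg; have -> : abs_gt g t = unitI `&` (fun x => `|g x|) @^-1` `]t, +oo[%classic.
  by apply/seteqP; split => x; rewrite /abs_gt/= in_itv/= andbT.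
apply: measurableI; first exact: mU.
have mn := measurableT_comp (@normr_measurable R setT) mg.
have mt : measurable (`]t, +oo[%classic : set (measurableTypeR R)) by exact: measurable_itv.
by have := mn measurableT _ mt; rewrite setTI.
Qed.

Lemma measurable_birkhoff_dev (f : R -> R) n :
  measurable_fun (setT : set (measurableTypeR R)) f ->
  measurable_fun (setT : set (measurableTypeR R)) (birkhoff_dev gamma nu f n).
Proof.
move=> mf; apply: measurable_funB => //; apply: measurable_sum => k.
exact: (measurableT_comp mf (measurable_iter_Tmap gamma k)).
Qed.

Lemma unitI_pos (x : R) : unitI x -> 0 <= x <= 1.
Proof. by rewrite /unitI/= in_itv. Qed.

Lemma exists_depth l : 0 < l -> exists2 s : R, 0 <= s & expR (- s `^ gamma) <= l.
Proof.
have g0 := gamma_gt0 hgamma; move=> l0.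
exists (`|ln l| `^ gamma^-1); first exact: powR_ge0.
rewrite -powRrM mulVf ?gt_eqF// powRr1// -[leRHS]lnK ?posrE//.
by rewrite ler_expR lerNl -normrN ler_norm.
Qed.

Lemma lipschitz_minr1 (l : R) (A : set R) : 0 < l ->
  [lipschitz (Num.min 1 ((x : R) / l) : R) | x in A].
Proof.
move=> l0; exists l^-1; split; first exact: num_real.
move=> M lM [x y] /= _; apply: (@le_trans _ _ (l^-1 * `|x - y|)).
  have -> : l^-1 * `|x - y| = `|x / l - y / l|.
    by rewrite -mulrBl normrM (@gtr0_norm _ l^-1) ?invr_gt0// mulrC.
  move: (x / l) (y / l) => a b.
  rewrite ler_norml; have := ler_norm (a - b); have := ler_norm (- (a - b)).
  by rewrite normrN; case: (leP 1 a); case: (leP 1 b) => *; apply/andP; split; lra.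
by rewrite ler_wpM2r// ltW.
Qed.

(** The observable is [1] above a small level and falls linearly to [0] at [0], with mean in
    [[2/3, 1]]. A deep start keeps it below [1/4] for [n] steps; conversely a deviation forces the
    sum of [phi = 1 - f] above [n / 2]. *)
Lemma lipschitz_deviations : exists (f : R -> R) (c1 c2 k1 k2 : R),
  [/\ [lipschitz f x | x in unitI], 0 < mean nu f,
      [/\ 0 < c1, 0 < c2, 0 < k1 & 0 < k2]
    & forall n : nat, (0 < n)%N ->
      ((c1 * expR (- k1 * n%:R `^ gamma))%:E
         <= nu (abs_gt (birkhoff_dev gamma nu f n) (n%:R * mean nu f / 2))
         <= (c2 * expR (- k2 * n%:R `^ gamma))%:E)%E].
Proof.
have mU' : measurable (unitI : set (measurableTypeR R)) by exact: mU.
have [A A0 hA] := cdf01_le_sqrt hgamma hnu.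
(* [1/8] is required by [large_deviation]; [1 / (3 A)] gives [F (level m0) <= 1/3], hence mean at
   least [2/3]. *)
pose e := Num.min 8^-1 (3^-1 / A).
have e0 : 0 < e by rewrite lt_min !divr_gt0//; lra.
have [m0 m00 hser] := level_series hgamma 0 e0.
have sl : Num.sqrt (level m0) <= e.
  have := hser m0 m0.+1 (leqnn _); rewrite big_nat1 expr0 mul1r//.
have [e8 eA] : e <= 8^-1 /\ e <= 3^-1 / A by rewrite /e !ge_min !lexx orbT.
have l0 := level_gt0 gamma m0; have l1 := level_le1 gamma m0; have l01 := level01 gamma m0.
have lE : level m0 = Num.sqrt (level m0) ^+ 2 by rewrite sqr_sqrtr// ltW.
have l2 : level m0 <= 2^-1 by rewrite lE; have := sqrtr_ge0 (level m0); nra.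
have F3 : F (level m0) <= 3^-1.
  apply: le_trans (hA _ l01) _; have := ler_wpM2l (ltW A0) (le_trans sl eA).
  by rewrite mulrCA divff ?mulr1// gt_eqF.
have [|C [kap [C0 kap0 hLD]]] := large_deviation hgamma hnu (q := 0%N) m00 l2.
  by move=> M; apply: le_trans e8; exact: hser.
pose f (x : R) := Num.min 1 (x / level m0).
have mf : measurable_fun (setT : set (measurableTypeR R)) f.
  by apply: measurable_minr => //; apply: measurable_funM.
have f01 x : 0 <= x -> 0 <= f x <= 1.
  by move=> x0; rewrite le_min ge_min lexx ler01 divr_ge0// ltW.
have fint : nu.-integrable unitI (EFin \o f).
  apply: (@bounded_integrable01 _ nu _ (1)) => // x /unitI_pos hx.
  have /andP[f0 f1] : 0 <= f x <= 1 by apply: f01; case/andP: hx.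
  by rewrite ger0_norm.
have cint c : nu.-integrable unitI (EFin \o (fun=> c : R)).
  by apply: (@bounded_integrable01 _ nu _ (`|c|)).
have nuU : fine (nu unitI) = 1 by case: hnu => -> .
have mean1 : mean nu f <= 1.
  have <- : \int[nu]_(x in unitI) 1 = 1 by rewrite Rintegral_cst ?nuU ?mulr1.
  apply: le_Rintegral => //.
  by move=> x /unitI_pos/andP[x0 _]; case/andP: (f01 x x0).
have mean23 : 2 / 3 <= mean nu f.
  have : \int[nu]_(x in unitI) (1 - f x) <= F (level m0).
    pose ind (x : R) : R := \1_(`[0, level m0]%classic) x.
    have -> : F (level m0) = \int[nu]_(x in unitI) ind x.
      rewrite /Rintegral integral_indic//.
      by rewrite setIidl//; apply: subset_itvl; rewrite bnd_simp.
    apply: le_Rintegral => //.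
    - exact: (integrableB mU (cint 1) fint).
    - apply: (@bounded_integrable01 _ nu _ (1)); first by apply: measurable_indic; exact: measurable_itv.
      by move=> x _; rewrite /ind indicE; case: (_ \in _); rewrite ?normr1 ?normr0.
    - move=> x /unitI_pos/andP[x0 x1]; rewrite /ind indicE mem_setE in_itv/= x0/=.
      case: (leP x (level m0)) => h; first by have := f01 x x0; rewrite mulr1n; lra.
      have -> : f x = 1 by apply/min_idPl; rewrite ler_pdivlMr// mul1r ltW.
      by rewrite subrr.
  rewrite RintegralB// Rintegral_cst//.
  by rewrite nuU mulr1 -/(mean nu f); lra.
have flip : [lipschitz f x | x in unitI] by exact: lipschitz_minr1.
have l4 : 0 < level m0 / 4 by rewrite divr_gt0.
have [s s0 hs] := exists_depth l4.
have D0 := dmax_gt0 hgamma.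
(* A start at depth [K n] loses at most [dmax] per step, so depth [s], where [f <= 1/4], remains at
   all times before [n]. *)
pose K := dmax gamma + s.
have K0 : 0 < K by rewrite /K; lra.
exists f, 1, C, (K `^ gamma), kap; split => //; first by lra.
  by split => //; exact: powR_gt0.
move=> n n0; have n0' : 0 < n%:R :> R by rewrite ltr0n.
have n1 : 1 <= n%:R :> R by rewrite ler1n.
have mB := measurable_abs_gt (n%:R * mean nu f / 2) (measurable_birkhoff_dev n mf).
set B := abs_gt _ _ in mB *; apply/andP; split.
  rewrite mul1r.
  have -> : - K `^ gamma * n%:R `^ gamma = - (K * n%:R) `^ gamma.
    by rewrite mulNr powRM// ltW.
  apply: expR_le_nu_deep => //; first by rewrite mulr_ge0// ltW.
  move=> x hx hdx; split; first by rewrite /unitI/= in_itv/=; lra.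
  have hsum : \sum_(0 <= k < n) f (iter k T x) <= n%:R / 4.
    apply: (@le_trans _ _ (\sum_(0 <= k < n) 4^-1)).
      rewrite big_nat_cond [leRHS]big_nat_cond; apply: ler_sum => k /andP[/andP[_ kn] _].
      have hk := iter_Tmap_in_pos hgamma k hx.
      have kn' : k%:R <= n%:R :> R by rewrite ler_nat ltnW.
      have : s <= depth (iter k T x).
        have := depth_iter_Tmap hgamma k hx; have := ler_wpM2r (ltW D0) kn'.
        have := ler_wpM2l s0 n1; move: hdx; rewrite /K; lra.
      rewrite (le_depth hgamma)// => /le_trans /(_ hs) h.
      by rewrite /f ge_min ler_pdivrMr//; apply/orP; right; lra.
    by rewrite sumr_const_nat subn0 -[_ *+ _]mulr_natr; lra.
  rewrite /birkhoff_dev ltr_normr; apply/orP; right.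
  have := ler_wpM2l (ltW n0') mean23; lra.
apply: le_trans (le_nu_pos mB _) _; first by move=> x [].
have := hLD (fun x => 1 - f x) _ _ n (B `&` `]0%R, 1%R]) n0.
rewrite divr1; apply.
- move=> x lx x1; have -> : f x = 1 by apply/min_idPl; rewrite ler_pdivlMr// mul1r ltW.
  by rewrite subrr.
- move=> x m _ lx xl; have x0 := lt_trans (level_gt0 gamma m.+1) lx.
  by rewrite expr0 gerBl; case/andP: (f01 x (ltW x0)).
- by apply: measurableI => //; exact: measurable_itv.
- move=> x [[/unitI_pos Ux hx] /=]; rewrite in_itv/= => hx01; split => //.
  rewrite sumrB sumr_const_nat subn0 -[1 *+ _]mulr_natr mul1r.
  have fs : 0 <= \sum_(0 <= k < n) f (iter k T x) <= n%:R.
    apply/andP; split.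
      apply: sumr_ge0 => k _; have /andP[h _] := iter_Tmap_in hgamma k Ux.
      by case/andP: (f01 _ h).
    apply: (@le_trans _ _ (\sum_(0 <= k < n) 1)).
      apply: ler_sum => k _; have /andP[h _] := iter_Tmap_in hgamma k Ux.
      by case/andP: (f01 _ h).
    by rewrite sumr_const_nat subn0.
  (* An upward deviation is impossible: it would make the sum exceed [3/2 * n * mean >= n], while
     [f <= 1]. *)
  move: hx; rewrite /birkhoff_dev ltr_normr.
  have := ler_wpM2l (ltW n0') mean23; have := ler_wpM2l (ltW n0') mean1.
  by move=> h1 h2 /orP[]; lra.
Qed.

End deviations.

(** * An unbounded observable: the excess depth *)

Section excess_depth.
Context {R : realType} (gamma : R) (hgamma : 0 < gamma <= 1).
Context (nu : probability (measurableTypeR R) R) (hnu : invariant_acpm gamma nu).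
Local Notation T := (Tmap gamma).
Local Notation F := (cdf01 nu).
Local Notation d := (dmin gamma).
Local Notation depth := (depth gamma).
Local Notation level := (level gamma).
Context (m0 : nat) (m0_gt0 : (0 < m0)%N).

(** Depth in units of [d], shifted so as to vanish above level [m0]; a large [m0] makes the mean
    small. *)
Definition excess (x : R) : R := Num.max 0 (depth x / d - m0%:R).

Let d0 : 0 < d := @dmin_gt0 R gamma.

Lemma measurable_excess : measurable_fun (setT : set (measurableTypeR R)) excess.
Proof.
apply: measurable_maxr => //; apply: measurable_funB => //.
by apply: measurable_funM => //; exact: measurable_depth.
Qed.

Lemma excess_ge0 x : 0 <= excess x.
Proof. by rewrite le_max lexx. Qed.

Lemma le_excess x : depth x / d - m0%:R <= excess x.
Proof. by rewrite le_max lexx orbT. Qed.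

Lemma excess_gt x t : 0 <= t -> t < excess x -> (t + m0%:R) * d < depth x.
Proof. by move=> t0; rewrite lt_max ltNge t0 /= -ltr_pdivlMr//; lra. Qed.

Lemma excess0 : excess 0 = 0.
Proof.
have z : depth 0 = 0.
  by rewrite /depth ln0// normr0 powR0// invr_neq0// gt_eqF// (gamma_gt0 hgamma).
by rewrite /excess z mul0r sub0r; apply/max_idPl; rewrite oppr_le0.
Qed.

Lemma excess_out x : level m0 < x -> x <= 1 -> excess x <= 0.
Proof.
move=> lx x1; have hx : 0 < x <= 1 by rewrite x1 (lt_trans (level_gt0 gamma m0) lx).
move: lx; rewrite ltNge le_level// -ltNge => h.
by rewrite ge_max lexx/= subr_le0 ler_pdivrMr// ltW.
Qed.

(** The depth may reach [m + 1] units between the two levels; the shift by [m0 >= 1] compensates for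
    the extra unit. *)
Lemma excess_in x m : (m0 <= m)%N -> level m.+1 < x -> x <= level m ->
  excess x <= m%:R ^+ 1.
Proof.
move=> m0m lx xl; have hx : 0 < x <= 1.
  by rewrite (le_trans xl (level_le1 gamma m)) (lt_trans (level_gt0 gamma _) lx).
move: lx; rewrite ltNge le_level// -ltNge => h.
rewrite expr1 ge_max ler0n/=.
have : depth x / d <= m.+1%:R by rewrite ler_pdivrMr// ltW.
have : 1 <= m0%:R :> R by rewrite ler1n.
by rewrite -natr1; lra.
Qed.

(** Layer-cake bound: where the excess is positive, all terms with [m <= excess x] equal [1], and
    there are more than [excess x] of them. *)
Lemma excess_le_series x : 0 <= x <= 1 ->
  ((excess x)%:E <= \sum_(0 <= m <oo) (\1_(`[0%R, level (m + m0)]%classic) x)%:E)%E.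
Proof.
move=> hx; set N := (Num.truncn (excess x)).+1.
have hge k : (0 <= k)%N -> true -> (0 <= (\1_(`[0%R, level (k + m0)]%classic) x : R)%:E)%E.
  by move=> _ _; rewrite lee_fin indicE.
have [e0|e0] := leP (excess x) 0.
  apply: (@le_trans _ _ 0%E); first by rewrite lee_fin.
  by apply: nneseries_ge0 => k; exact: hge.
apply: le_trans (nneseries_lim_ge N hge).
have x0 : 0 < x.
  case/andP: hx; rewrite le_eqVlt => /predU1P[xz|//].
  by move: e0; rewrite -xz excess0 ltxx.
have hx' : 0 < x <= 1 by rewrite x0; case/andP: hx.
rewrite (eq_big_nat _ _ (F2 := fun=> 1%E)); last first.
  move=> k /andP[_ kN]; rewrite indicE mem_setE in_itv/= (ltW x0)/=.
  rewrite le_level// natrD.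
  have ke : k%:R <= excess x.
    apply: (@le_trans _ _ (Num.truncn (excess x))%:R); first by rewrite ler_nat -ltnS.
    by rewrite truncn_le ltW.
  have : k%:R + m0%:R <= depth x / d.
    move: ke e0; rewrite /excess; case: (leP 0 (depth x / d - m0%:R)) => [_ h1 h2|_ _]; last by rewrite ltxx.
    by lra.
  by rewrite ler_pdivlMr// => ->.
rewrite sumEFin sumr_const_nat subn0 lee_fin.
by apply: ltW; exact: truncnS_gt.
Qed.

Lemma excess_integrable e : (forall M, \sum_(m0 <= m < M) F (level m) <= e) ->
  nu.-integrable unitI (EFin \o excess) /\ mean nu excess <= e.
Proof.
move=> he; have mU : measurable (unitI : set (measurableTypeR R)) by exact: measurable_itv.
have mI m : measurable (`[0%R, level m]%classic : set (measurableTypeR R)) by exact: measurable_itv.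
have meE : measurable_fun (unitI : set (measurableTypeR R)) (EFin \o excess).
  by apply/measurable_EFinP; apply: measurable_funTS; exact: measurable_excess.
have mi m : measurable_fun (unitI : set (measurableTypeR R))
    (fun x : R => (\1_(`[0%R, level (m + m0)]%classic) x : R)%:E).
  by apply/measurable_EFinP; apply: measurable_funTS; exact: measurable_indic.
have i0 m x : (0 <= (\1_(`[0%R, level (m + m0)]%classic) x : R)%:E)%E.
  by rewrite lee_fin indicE.
have bound : (\int[nu]_(x in unitI) (excess x)%:E <= e%:E)%E.
  apply: (@le_trans _ _ (\int[nu]_(x in unitI)
    \sum_(0 <= m <oo) (\1_(`[0%R, level (m + m0)]%classic) x : R)%:E)%E).
    apply: ge0_le_integral => //.
    - by move=> x _; rewrite lee_fin excess_ge0.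
    - by apply: ge0_emeasurable_sum => // k x _ _; exact: i0.
    - by move=> x /unitI_pos; exact: excess_le_series.
  rewrite integral_nneseries//.
  apply: lime_le; first by apply: is_cvg_nneseries => k _ _; exact: integral_ge0.
  apply: nearW => M.
  rewrite (eq_bigr (fun m => (F (level (m + m0)))%:E)); last first.
    move=> m _; rewrite integral_indic// EFin_cdf01 setIidl//.
    by apply: subset_itvl; rewrite bnd_simp level_le1.
  rewrite sumEFin lee_fin; apply: le_trans (he (M + m0)%N).
  by rewrite -{2}(add0n m0) big_addn addnK.
have int0 : (0 <= \int[nu]_(x in unitI) (excess x)%:E)%E.
  by apply: integral_ge0 => x _; rewrite lee_fin excess_ge0.
split.
  apply/integrableP; split => //.
  have -> : (\int[nu]_(x in unitI) `|(EFin \o excess) x| =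
      \int[nu]_(x in unitI) (excess x)%:E)%E.
    by apply: eq_integral => x _; rewrite /= ger0_norm// excess_ge0.
  exact: le_lt_trans bound (ltry _).
rewrite /mean /Rintegral -lee_fin fineK// ge0_fin_numE//.
by apply: le_lt_trans bound (ltry _).
Qed.

End excess_depth.

(** * Tails and deviations of the excess depth *)

Section unbounded_deviations.
Context {R : realType} (gamma : R) (hgamma : 0 < gamma <= 1).
Context (nu : probability (measurableTypeR R) R) (hnu : invariant_acpm gamma nu).
Local Notation T := (Tmap gamma).
Local Notation F := (cdf01 nu).
Local Notation d := (dmin gamma).
Local Notation depth := (depth gamma).
Local Notation level := (level gamma).

(** Depth [d (t + m0 + 1)] forces an excess above [t]; [powRD_le] then separates a constant factor
    from the decay in [t]. *)
Lemma excess_tail m0 t : 0 < t ->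
  ((expR (- (2 * (d * (m0%:R + 1))) `^ gamma) * expR (- (2 * d) `^ gamma * t `^ gamma))%:E <=
    nu (abs_gt (excess gamma m0) t))%E.
Proof.
move=> t0; have d0 := @dmin_gt0 R gamma; have g0 := gamma_gt0 hgamma.
have m1 : 0 < m0%:R + 1 :> R by rewrite ltr_wpDl.
have a0 : 0 <= d * (t + (m0%:R + 1)) by rewrite (mulr_ge0 (ltW d0))// (addr_ge0 (ltW t0))// ltW.
apply: le_trans (expR_le_nu_deep hgamma hnu _ a0 _).
- rewrite -expRD lee_fin ler_expR mulNr -powRM ?(ltW t0)//; last by rewrite mulr_ge0// ltW.
  rewrite -opprD lerN2 mulrDr.
  have h1 : 0 <= d * t by rewrite mulr_ge0 ?ltW.
  have h2 : 0 <= d * (m0%:R + 1) by rewrite mulr_ge0 ?ltW.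
  apply: le_trans (powRD_le h1 h2 (ltW g0)) _.
  by rewrite addrC -(mulrA 2 d t).
- apply: measurable_abs_gt; exact: measurable_excess.
- move=> x hx hd; split; first by rewrite /unitI/= in_itv/=; lra.
  rewrite ger0_norm ?excess_ge0//; apply: lt_le_trans (le_excess gamma m0 x).
  have : t + (m0%:R + 1) <= depth x / d by rewrite ler_pdivlMr// mulrC.
  lra.
Qed.

Lemma excess_tail_le A m0 t : (forall z, 0 <= z <= 1 -> F z <= A * Num.sqrt z) -> 0 < t ->
  (nu (abs_gt (excess gamma m0) t) <= (A * expR (- (d `^ gamma / 2) * t `^ gamma))%:E)%E.
Proof.
move=> hA t0; have d0 := @dmin_gt0 R gamma.
have mE := measurable_abs_gt t (measurable_excess gamma m0).
apply: le_trans (le_nu_pos hnu mE _) _; first by move=> x [].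
pose z := expR (- (t * d) `^ gamma).
have td : 0 <= t * d by rewrite mulr_ge0 ?ltW.
have z01 : 0 <= z <= 1 by rewrite expR_ge0 expR_le1 oppr_le0 powR_ge0.
apply: (@le_trans _ _ (F z)%:E).
  rewrite EFin_cdf01; apply: le_nu => //.
    by apply: measurableI => //; exact: measurable_itv.
  move=> x [[_ hx]]; rewrite /= !in_itv/= => hx1.
  have x0 : 0 <= x by lra.
  rewrite x0 -(le_depth hgamma)//.
  move: hx; rewrite ger0_norm ?excess_ge0// => /(excess_gt (ltW t0)) h.
  by apply: le_trans (ltW h); rewrite ler_wpM2r ?(ltW d0)// lerDl.
rewrite lee_fin; apply: le_trans (hA _ z01) _.
have -> : Num.sqrt z = expR (- (d `^ gamma / 2) * t `^ gamma).
  have -> : z = expR (- (d `^ gamma / 2) * t `^ gamma) ^+ 2.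
    by rewrite -expRM_natl /z powRM ?ltW//; congr expR; field.
  by rewrite sqrtr_sqr ger0_norm// expR_ge0.
by [].
Qed.

Lemma excess_unbounded m0 : ~ [bounded excess gamma m0 x | x in unitI].
Proof.
have d0 := @dmin_gt0 R gamma.
move=> [M [_ hM]]; have := hM (M + 1) ltac:(by rewrite ltrDl).
pose a := (`|M| + 2 + m0%:R) * d; have a0 : 0 <= a by rewrite mulr_ge0 ?addr_ge0// ltW.
have z0 := expR_gt0 (- a `^ gamma).
have z1 : expR (- a `^ gamma) <= 1 by rewrite expR_le1 oppr_le0 powR_ge0.
move=> /(_ (expR (- a `^ gamma))) /=.
rewrite /unitI/= in_itv/= (ltW z0) z1 => /(_ isT).
rewrite ger0_norm ?excess_ge0//; apply/negP; rewrite -ltNge.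
apply: lt_le_trans (le_excess gamma m0 _).
have : a <= depth (expR (- a `^ gamma)) by rewrite le_depth// z0.
rewrite /a -ler_pdivlMr//; have := ler_norm M; lra.
Qed.

(** Start at a depth of order [r = sqrt n]. During the first [p] steps, [p] the integer part of [r],
    the excess stays above [6 r], and [6 r p >= 3 n] because [r <= 2 p]. *)
Lemma excess_birkhoff_lower m0 n x : 0 < x <= 1 -> (0 < n)%N ->
  (dmax gamma + d * (m0%:R + 6)) * n%:R `^ 2^-1 <= depth x ->
  3 * n%:R <= \sum_(0 <= k < n) excess gamma m0 (iter k T x).
Proof.
move=> hx n0 hdx; have d0 := @dmin_gt0 R gamma; have D0 := dmax_gt0 hgamma.
have n1 : 1 <= n%:R :> R by rewrite ler1n.
have n0' : 0 <= n%:R :> R by rewrite ler0n.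
move: hdx; rewrite powR12_sqrt//; set r := Num.sqrt n%:R => hdx.
have r2 : r * r = n%:R by rewrite -expr2 sqr_sqrtr.
have r1 : 1 <= r by rewrite -sqrtr1; exact: ler_wsqrtr.
have r0 : 0 <= r by lra.
pose p := Num.truncn r.
have pr : p%:R <= r by rewrite truncn_le.
have rp : r < p%:R + 1 by rewrite natr1; exact: truncnS_gt.
have p1 : 1 <= p%:R :> R.
  by rewrite ler1n lt0n; apply/eqP => pz; move: rp; rewrite pz add0r ltNge r1.
have pn : (p <= n)%N by rewrite -(ler_nat R) -r2; apply: le_trans pr _; rewrite ler_peMl.
rewrite (big_cat_nat (leq0n p) pn)/=.
apply: (@le_trans _ _ (\sum_(0 <= k < p) excess gamma m0 (iter k T x))); last first.
  by rewrite lerDl; apply: sumr_ge0 => k _; exact: excess_ge0.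
apply: (@le_trans _ _ (\sum_(0 <= k < p) 6 * r)).
  rewrite sumr_const_nat subn0 -[_ *+ p]mulr_natr -r2.
  have : r * r <= r * (2 * p%:R) by rewrite ler_wpM2l//; lra.
  lra.
rewrite big_nat_cond [leRHS]big_nat_cond; apply: ler_sum => k /andP[/andP[_ kp] _].
apply: le_trans (le_excess gamma m0 _).
have kr : k%:R <= r by apply: le_trans pr; rewrite ler_nat ltnW.
have h1 := depth_iter_Tmap hgamma k hx.
have h2 := ler_wpM2r (ltW D0) kr.
rewrite lerBrDr ler_pdivlMr//.
have : m0%:R * d <= m0%:R * d * r by rewrite ler_peMr// mulr_ge0// ltW.
nra.
Qed.

(** The observable is [excess] for a large [m0], with [delta = gamma^-1]. The exponent
    [gamma / (1 + gamma * delta)] is then [gamma / 2], the one [large_deviation] gives for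
    [q = 1]. *)
Lemma unbounded_deviations :
  exists (f : R -> R) (A1 A2 B1 B2 delta c1 c2 k1 k2 : R),
    [/\ [/\ measurable_fun (unitI : set (measurableTypeR R)) f,
            nu.-integrable unitI (fun x => (f x)%:E)
          & ~ [bounded f x | x in unitI]],
        [/\ 0 < A1, 0 < A2, 0 < B1, 0 < B2 & 0 < delta],
        (forall t : R, 0 < t ->
          ((A1 * expR (- B1 * t `^ delta^-1))%:E
             <= nu (abs_gt f t)
             <= (A2 * expR (- B2 * t `^ delta^-1))%:E)%E),
        [/\ 0 < c1, 0 < c2, 0 < k1 & 0 < k2]
      & forall n : nat, (1 <= n)%N ->
        ((c1 * expR (- k1 * n%:R `^ (gamma / (1 + gamma * delta))))%:E
           <= nu (abs_gt (birkhoff_dev gamma nu f n) n%:R)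
           <= (c2 * expR (- k2 * n%:R `^ (gamma / (1 + gamma * delta))))%:E)%E].
Proof.
have g0 := gamma_gt0 hgamma; have d0 := @dmin_gt0 R gamma; have D0 := dmax_gt0 hgamma.
have [A A0 hA] := cdf01_le_sqrt hgamma hnu.
(* [1/8] is required by [large_deviation]; [1 / (2 A)] makes the mean at most [1/2]. *)
pose e := Num.min 8^-1 (2^-1 / A).
have e0 : 0 < e by rewrite lt_min !divr_gt0//; lra.
have [m0 m00 hser] := level_series hgamma 1 e0.
have [e8 eA] : e <= 8^-1 /\ e <= 2^-1 / A by rewrite /e !ge_min !lexx orbT.
have s0 m : 0 <= Num.sqrt (level m) by exact: sqrtr_ge0.
have sm m : (0 < m)%N -> Num.sqrt (level m) <= m%:R ^+ 1 * Num.sqrt (level m).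
  by move=> mp; rewrite expr1 ler_peMl// ler1n.
have sl : Num.sqrt (level m0) <= 8^-1.
  apply: le_trans (sm _ m00) _; apply: le_trans e8.
  by have := hser m0 m0.+1 (leqnn _); rewrite big_nat1.
have l2 : level m0 <= 2^-1.
  have lE : level m0 = Num.sqrt (level m0) ^+ 2 by rewrite sqr_sqrtr// ltW// level_gt0.
  by rewrite lE; have := s0 m0; nra.
have [|C [kap [C0 kap0 hLD]]] := large_deviation hgamma hnu (q := 1%N) m00 l2.
  by move=> M; apply: le_trans e8; exact: hser.
have hF M : \sum_(m0 <= m < M) F (level m) <= 2^-1.
  apply: (@le_trans _ _ (\sum_(m0 <= m < M) A * (m%:R ^+ 1 * Num.sqrt (level m)))).
    rewrite big_nat_cond [leRHS]big_nat_cond; apply: ler_sum => m /andP[/andP[m0m _] _].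
    apply: le_trans (hA _ (level01 gamma m)) _; rewrite ler_wpM2l ?(ltW A0)//.
    by apply: sm; exact: leq_trans m0m.
  rewrite -mulr_sumr; have := ler_wpM2l (ltW A0) (le_trans (hser m0 M (leqnn _)) eA).
  by rewrite mulrCA divff ?mulr1// gt_eqF.
have [fint mean2] := excess_integrable hgamma hF.
set f := excess gamma m0 in fint mean2.
have mf : measurable_fun (setT : set (measurableTypeR R)) f := measurable_excess gamma m0.
have mean0 : 0 <= mean nu f by apply: Rintegral_ge0 => x _; exact: excess_ge0.
pose K := dmax gamma + d * (m0%:R + 6).
have K0 : 0 < K by rewrite addr_gt0// mulr_gt0// ltr_wpDl.
exists f, (expR (- (2 * (d * (m0%:R + 1))) `^ gamma)), A, ((2 * d) `^ gamma), (d `^ gamma / 2),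
  gamma^-1, 1, C, (K `^ gamma), kap.
have -> : gamma / (1 + gamma * gamma^-1) = gamma / 2%:R by rewrite divff ?gt_eqF.
rewrite invrK; split.
- by split; [exact: measurable_funTS | exact: fint | exact: excess_unbounded].
- by split; rewrite ?expR_gt0 ?invr_gt0// ?divr_gt0// powR_gt0// mulr_gt0.
- by move=> t t0; rewrite excess_tail//= excess_tail_le.
- by split => //; exact: powR_gt0.
move=> n n0; have n0' : 0 < n%:R :> R by rewrite ltr0n.
have mB := measurable_abs_gt n%:R (measurable_birkhoff_dev gamma nu n mf).
set B := abs_gt _ _ in mB *; apply/andP; split.
  rewrite mul1r.
  have -> : - K `^ gamma * n%:R `^ (gamma / 2%:R) = - (K * n%:R `^ 2^-1) `^ gamma.
    by rewrite mulNr powRM ?powR_ge0 ?(ltW K0)// -powRrM (mulrC 2^-1).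
  apply: (expR_le_nu_deep hgamma hnu) => //; first by rewrite mulr_ge0 ?powR_ge0// ltW.
  move=> x hx hdx; split; first by rewrite /unitI/= in_itv/=; lra.
  have := excess_birkhoff_lower hx n0 hdx; rewrite -/f /birkhoff_dev ltr_normr.
  (* A sum of at least [3 n] exceeds [n * mean] by more than [n]. *)
  move: (\sum_(_ <= _ < _) _) => S hS; apply/orP; left.
  have := ler_wpM2l (ltW n0') mean2; lra.
apply: le_trans (le_nu_pos hnu mB _) _; first by move=> x [].
apply: (hLD f) => //.
- exact: excess_out.
- by move=> x m; exact: excess_in.
- by apply: measurableI => //; exact: measurable_itv.
- move=> x [[/unitI_pos Ux hx] /=]; rewrite in_itv/= => hx01; split => //.
  have fs : 0 <= \sum_(0 <= k < n) f (iter k T x).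
    by apply: sumr_ge0 => k _; exact: excess_ge0.
  move: hx fs; rewrite /birkhoff_dev ltr_normr; move: (\sum_(_ <= _ < _) _) => S hS S0.
  have := ler_wpM2l (ltW n0') mean2; have := mulr_ge0 (ltW n0') mean0.
  (* A downward deviation is excluded by [f >= 0] and mean at most [1/2]; an upward one makes the
     sum exceed [n]. *)
  by case/orP: hS => hS; lra.
Qed.

End unbounded_deviations.

Theorem theorem5p2 (R : realType) (gamma : R)
    (hgamma : 0 < gamma <= 1)
    (nu : probability (measurableTypeR R) R)
    (hnu : invariant_acpm gamma nu) :
  (exists (f : R -> R) (c1 c2 k1 k2 : R),
    [/\ [lipschitz f x | x in unitI], 0 < mean nu f,
        [/\ 0 < c1, 0 < c2, 0 < k1 & 0 < k2]
      & forall n : nat, 2 / mean nu f < n%:R ->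
        ((c1 * expR (- k1 * n%:R `^ gamma))%:E
           <= nu (abs_gt (birkhoff_dev gamma nu f n) (n%:R * mean nu f / 2))
           <= (c2 * expR (- k2 * n%:R `^ gamma))%:E)%E])
  /\
  (exists (f : R -> R) (A1 A2 B1 B2 delta c1 c2 k1 k2 : R),
    [/\ [/\ measurable_fun (unitI : set (measurableTypeR R)) f,
            nu.-integrable unitI (fun x => (f x)%:E)
          & ~ [bounded f x | x in unitI]],
        [/\ 0 < A1, 0 < A2, 0 < B1, 0 < B2 & 0 < delta],
        (forall t : R, 0 < t ->
          ((A1 * expR (- B1 * t `^ delta^-1))%:E
             <= nu (abs_gt f t)
             <= (A2 * expR (- B2 * t `^ delta^-1))%:E)%E),
        [/\ 0 < c1, 0 < c2, 0 < k1 & 0 < k2]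
      & forall n : nat, (1 <= n)%N ->
        ((c1 * expR (- k1 * n%:R `^ (gamma / (1 + gamma * delta))))%:E
           <= nu (abs_gt (birkhoff_dev gamma nu f n) n%:R)
           <= (c2 * expR (- k2 * n%:R `^ (gamma / (1 + gamma * delta))))%:E)%E]).
Proof.
split; last exact: unbounded_deviations.
have [f [c1 [c2 [k1 [k2 [flip fm c0 hf]]]]]] := lipschitz_deviations hgamma hnu.
exists f, c1, c2, k1, k2; split => // n hn; apply: hf.
by rewrite -(ltr0n R); apply: lt_trans hn; rewrite divr_gt0.
Qed.
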